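(* In the setting described in the context, for any $\phi\ge\sqrt n$ the expected number of edges on the path output by the shadow vertex algorithm (from $x_0$ to a vertex $x_c$ maximizing $c^{\mathsf T}x$ over $P$) is $O\big(\frac{mn^2}{\delta^2}+\frac{m\sqrt n\,\phi}{\delta}\big)$.
   Context: Let $A=[a_1,\dots,a_m]^{\mathsf T}\in\mathbb{R}^{m\times n}$ with $\|a_i\|=1$ for all $i$ (Euclidean norm), $b\in\mathbb{R}^m$, and assume $P=\{x\in\mathbb{R}^n\mid Ax\le b\}$ is bounded and non-degenerate (every vertex has exactly $n$ tight constraints, which are linearly independent). Let $\delta$ be the minimum, over all $I\subseteq[m]$ and $j\in[m]$ with $a_j\notin\operatorname{span}\{a_i\mid i\in I\}$, of the distance from $a_j$ to $\operatorname{span}\{a_i\mid i\in I\}$. Let $c_0\in\mathbb{R}^n$ with $\|c_0\|=1$ and let $x_0$ be a vertex of $P$. The shadow vertex algorithm with parameter $\phi$: (1) for each $i$ choose an arbitrary interval $I_i\subseteq[-1,1]$ of length $1/\phi$ containing $(c_0)_i$, and draw $c_i$ independently uniformly from $I_i$; (2) let $u_1,\dots,u_n$ be the $n$ linearly independent rows of $A$ with $u_k^{\mathsf T}x_0=b_k$ (the tight rows at $x_0$); (3) draw $\lambda\in(0,1]^n$ uniformly at random (independent of $c$); (4) set $w=-[u_1,\dots,u_n]\lambda$; (5) project $P$ onto the plane via $\pi(x)=(c^{\mathsf T}x,w^{\mathsf T}x)$, obtaining polygon $P'=\pi(P)$; (6) walk from $\pi(x_0)$ along the edges of $P'$ (its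 lower envelope) in increasing direction of the first coordinate until a rightmost vertex of $P'$ is reached; each edge of $P'$ traversed corresponds to an edge of $P$, and the output path is the corresponding path of vertices of $P$ from $x_0$ to the vertex $x_c$ projected onto that rightmost vertex. *)

(* Defs.v *)
From mathcomp Require Export all_boot all_order all_algebra.
From mathcomp Require Export all_classical all_reals all_analysis.
Export Order.TTheory GRing.Theory Num.Theory.
Export numFieldNormedType.Exports.

Set Implicit Arguments.
Unset Strict Implicit.
Unset Printing Implicit Defensive.

Local Open Scope classical_set_scope.
Local Open Scope ring_scope.

Section Geometry.
Context {R : realType}.

Definition dot n (u v : 'cV[R]_n) : R := (u^T *m v) 0 0.

(* Euclidean norm: the canonical norm `|_| on matrices is the sup norm. *)
Definition enorm n (u : 'cV[R]_n) : R := Num.sqrt (dot u u).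

Definition segment n (x y : 'cV[R]_n) : set 'cV[R]_n :=
  [set (1 - t) *: x + t *: y | t in `[0, 1]].

(* Nonempty faces in the sense of polytope theory: the sets of maximizers of a
   linear functional; f = 0 gives Q itself. *)
Definition is_face n (Q F : set 'cV[R]_n) : Prop :=
  exists f : 'cV[R]_n,
    F = [set x | Q x /\ forall y, Q y -> dot f y <= dot f x].

Definition is_vertex n (Q : set 'cV[R]_n) (x : 'cV[R]_n) : Prop :=
  is_face Q [set x].

(* x and y are the two end points of an edge (one-dimensional face) of Q. *)
Definition is_edge n (Q : set 'cV[R]_n) (x y : 'cV[R]_n) : Prop :=
  x <> y /\ is_face Q (segment x y).

Definition lower_envelope (Q : set 'cV[R]_2) : set 'cV[R]_2 :=
  [set z | Q z /\ forall z', Q z' -> z' 0 0 = z 0 0 -> z 1 0 <= z' 1 0].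

End Geometry.

Section Polyhedron.
Context {R : realType} {m n : nat}.
Implicit Types (A : 'M[R]_(m, n)) (b : 'cV[R]_m) (x c w : 'cV[R]_n).

Definition polyhedron A b : set 'cV[R]_n :=
  [set x | forall i, (A *m x) i 0 <= b i 0].

Definition tight A b x : {set 'I_m} := [set i | (A *m x) i 0 == b i 0]%SET.

Definition nondegenerate A b : Prop :=
  forall x, is_vertex (polyhedron A b) x ->
    #|tight A b x| = n /\ row_free (rowsub (@enum_val _ (mem (tight A b x))) A).

Definition row_span A (I : {set 'I_m}) : 'M[R]_n :=
  (\sum_(i in I) <<row i A>>)%MS.

Definition dist_row_span A (I : {set 'I_m}) (j : 'I_m) : R :=
  inf [set enorm (row j A - v)^T |
        v in [set v : 'rV[R]_n | (v <= row_span A I)%MS]].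

(* The set below is finite, and nonempty as soon as A has a nonzero row (take
   I empty), so that the infimum is then a minimum. *)
Definition delta A : R :=
  inf [set dist_row_span A Ij.1 Ij.2 |
        Ij in [set Ij : {set 'I_m} * 'I_m |
                ~~ (row Ij.2 A <= row_span A Ij.1)%MS]].

Definition shadow c w x : 'cV[R]_2 :=
  \col_(k < 2) if k == 0 then dot c x else dot w x.

Definition shadow_step A b c w x y : Prop :=
  let P := polyhedron A b in
  let P' := shadow c w @` P in
  [/\ is_edge P x y,
      is_edge P' (shadow c w x) (shadow c w y),
      segment (shadow c w x) (shadow c w y) `<=` lower_envelope P' &
      (shadow c w x) 0 0 < (shadow c w y) 0 0].

(* The shadow edges are followed until the first coordinate is maximal.
   x0 :: p lists the vertices of the path, which thus has [size p] edges. *)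
Definition shadow_path A b c w x0 (p : seq 'cV[R]_n) : Prop :=
  path (fun x y => `[< shadow_step A b c w x y >]) x0 p /\
  forall y, polyhedron A b y -> dot c y <= dot c (last x0 p).

(* u enumerates the rows of A that are tight at the starting vertex. *)
Definition shadow_objective A (u : 'I_n -> 'I_m) (lam : 'cV[R]_n) : 'cV[R]_n :=
  - ((rowsub u A)^T *m lam).

End Polyhedron.

Section Probability.
Context {R : realType} {d : measure_display} {T : measurableType d}.
Variable P : probability T R.

Definition mutually_independent (I : finType) (X : I -> {RV P >-> R}) : Prop :=
  forall (J : {set I}) (B : I -> set R), (forall i, measurable (B i)) ->
    P (\bigcap_(i in [set` J]) X i @^-1` B i) =
    (\prod_(i in J) P (X i @^-1` B i))%E.

End Probability.

(* Main.v *)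
Require Import Defs.
From mathcomp Require Import ring lra zify measurable_realfun.

(** Since [-w = sum_k lam_k u_k], the path follows the walls of the normal fan
    crossed by the ray [s c - w], [s > 0], which starts in the normal cone of
    [x0]. Fix a row [a_i] and a point [q] of the ray. Among the vertices of the
    facet of [a_i] at most one has [q + theta a_i] in the interior of its normal
    cone for some [theta], and it does not depend on [theta]. If the ray is
    about to leave that cone through the wall omitting [a_i], the coordinate of
    [q] along [a_i] lies in a short interval. Hence the set of bad [q] meets
    every line of direction [a_i] in a short interval, and the probability of
    this event is bounded by that length times the density of the random vector
    in the direction [a_i].

    For slopes [s <= n] the randomness of [lam] is used: [a_i = sum_k alpha_k u_k]
    with [|alpha_k| <= 1/delta]. For slopes [s > n] the ray is parametrized by
    [1/s] and the randomness of [c] is used, the [l1] norm of [a_i] being at most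
    [sqrt n]. Cutting the parameter range into slots of length tending to [0],
    almost surely each edge eventually has its own slot, and Fatou's lemma
    bounds the expected number of edges. *)

Set Implicit Arguments.
Unset Strict Implicit.
Unset Printing Implicit Defensive.

Local Open Scope classical_set_scope.
Local Open Scope ring_scope.

(** * Uniform random vectors *)

(** The orthants form a generating family stable under intersection, so a finite measure on
    [vec R I] is determined by its joint distribution function. *)
Definition lower_orthants (R : realType) (I : finType) : set (set (I -> R)) :=
  range (fun x => [set z | forall i, z i <= x i]).

Notation vec R I := (g_sigma_algebraType (@lower_orthants R I)).

Section UniformVector.
Context {R : realType} {I : finType}.

Lemma measurable_lower_orthant (x : I -> R) :
  measurable ([set z | forall i, z i <= x i] : set (vec R I)).
Proof. by apply: sub_sigma_algebra; exists x. Qed.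

Lemma vec_le_nat (z : I -> R) : exists k : nat, forall i, z i <= k%:R.
Proof.
exists (\max_i (Num.bound (z i)))%N => i.
apply: le_trans (ler_norm _) (le_trans (ltW (archi_boundP (normr_ge0 _))) _).
have -> : Num.bound `|z i| = Num.bound (z i) by rewrite /Num.bound normr_id.
by rewrite ler_nat; exact: (leq_bigmax_cond (F := fun i => Num.bound (z i))).
Qed.

Lemma measurable_coord (i : I) : measurable_fun setT (fun z : vec R I => z i).
Proof.
apply: (measurability _ (RGenOInfty.measurableE R)) => // _ [_ [x ->] <-].
rewrite setTI.
(* The complementary half-space is a countable union of orthants: coordinate [i] is bounded by [x],
   all others by a growing [k]. *)
have -> : (fun z : vec R I => z i) @^-1` `]x, +oo[ =
   ~` \bigcup_(k in [set: nat])
      [set z : vec R I | forall j, z j <= if j == i then x else k%:R].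
  apply/seteqP; split => [z /= | z /=].
    rewrite in_itv/= andbT => xz [k _ /= /(_ i)]; rewrite eqxx => zx.
    by move: xz; rewrite ltNge zx.
  move=> H; rewrite in_itv/= andbT ltNge; apply/negP => zx; apply: H.
  have [k zk] := vec_le_nat z.
  by exists k => //= j; case: eqP => [->|].
apply: measurableC; apply: bigcupT_measurable => k.
exact: measurable_lower_orthant.
Qed.

Lemma measurable_vec {d} {T : measurableType d} (Z : T -> I -> R) :
  (forall i, measurable_fun setT (fun t => Z t i)) ->
  measurable_fun setT (Z : T -> vec R I).
Proof.
move=> mZ.
apply: (@measurability _ _ T (vec R I) setT Z (@lower_orthants R I)) => //.
move=> _ [_ [x _ <-] <-].
rewrite setTI.
have -> : Z @^-1` [set z | forall i, z i <= x i] =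
    \bigcap_(i in [set: I]) ((fun t => Z t i) @^-1` `]-oo, x i]).
  apply/seteqP; split => [t /= H i _ | t H i]; first by rewrite /= in_itv/=.
  by have := H i Logic.I; rewrite /= in_itv.
apply: fin_bigcap_measurable => // i _.
by rewrite -[X in measurable X]setTI; apply: mZ.
Qed.

Context {d : measure_display} {T : measurableType d} {P : probability T R}.

Lemma uniform_itv_cc (X : {RV P >-> R}) (a b x y : R) (ab : a < b) :
  (forall B, measurable B -> distribution P X B = uniform_prob ab B) ->
  a <= x -> x <= y -> y <= b ->
  P [set t | x <= X t <= y] = ((y - x) / (b - a))%:E.
Proof.
move=> hX ax xy yb.
have := hX `[x, y]%classic (measurable_itv _).
rewrite /distribution /pushforward /=.
have -> : X @^-1` `[x, y] = [set t | x <= X t <= y].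
  by apply/seteqP; split => t /=; rewrite in_itv.
move=> ->; rewrite /uniform_prob integral_uniform_pdf.
have -> : `[x, y] `&` `[a, b] = `[x, y]%classic :> set R.
  apply/seteqP; split => z /=; first by case.
  rewrite !in_itv/= => /andP[xz zy]; rewrite xz zy; split => //.
  by rewrite (le_trans ax xz) (le_trans zy yb).
under eq_integral => z.
  rewrite inE/= in_itv/= => /andP[xz zy].
  rewrite /uniform_pdf (le_trans ax xz) (le_trans zy yb).
  over.
rewrite integral_cst//= lebesgue_measure_itv/= lte_fin.
case: ltP => // yx.
  by rewrite -EFinB -EFinM mulrC.
by rewrite mule0; have -> : x = y by [apply/eqP; rewrite eq_le xy]; rewrite subrr mul0r.
Qed.

(** [X] almost surely lies in [[a, b]], so a ray can be cut down to an interval inside the support,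
    where [uniform_itv_cc] applies. *)
Lemma uniform_ray (X : {RV P >-> R}) (a b x : R) (ab : a < b) :
  (forall B, measurable B -> distribution P X B = uniform_prob ab B) ->
  P [set t | X t <= x] = P [set t | a <= X t <= Num.min x b].
Proof.
move=> hX.
have mX (B : set R) : measurable B -> measurable (X @^-1` B).
  by move=> mB; rewrite -[X in measurable X]setTI; exact: measurable_funP.
have P1 : P (X @^-1` `[a, b]) = 1%E.
  have -> : X @^-1` `[a, b] = [set t | a <= X t <= b].
    by apply/seteqP; split => t /=; rewrite in_itv.
  rewrite (uniform_itv_cc hX) ?lexx// ?ltW//.
  by rewrite divff// lt0r_neq0// subr_gt0.
have P0 : P (~` (X @^-1` `[a, b])) = 0%E.
  by rewrite probability_setC ?P1 ?subee//; exact: mX.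
have -> : [set t | X t <= x] = X @^-1` `]-oo, x].
  by apply/seteqP; split => t /=; rewrite in_itv.
have -> : [set t | a <= X t <= Num.min x b] = X @^-1` `]-oo, x] `&` X @^-1` `[a, b].
  apply/seteqP; split => t /=; rewrite !in_itv/= le_min.
    by move=> /and3P[-> -> ->].
  by move=> [-> /andP[-> ->]].
rewrite -{1}[X @^-1` `]-oo, x]](setIT) -(setUv (X @^-1` `[a, b])) setIUr measureU//.
- rewrite [X in (_ + X)%E](_ : _ = 0%E) ?adde0//.
  apply/eqP; rewrite eq_le measure_ge0 andbT -P0.
  apply: le_measure; rewrite ?inE.
  + by apply: measurableI; [|apply: measurableC]; exact: mX.
  + by apply: measurableC; exact: mX.
  + exact: subIsetr.
- by apply: measurableI; exact: mX.
- by apply: measurableI; [|apply: measurableC]; exact: mX.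
- by rewrite setIACA setICr setI0.
Qed.

End UniformVector.

(** * Probability of sets with short sections along a direction *)

Section Core.
Context {R : realType} {I : finType}.
Context {d : measure_display} {T : measurableType d} {P : probability T R}.
Variables (Z : I -> {RV P >-> R}) (lo hi : I -> R).
Hypothesis lohi : forall i, lo i < hi i.
Hypothesis Z_unif : forall i B, measurable B ->
  distribution P (Z i) B = uniform_prob (lohi i) B.
Hypothesis Z_indep : mutually_independent Z.

Lemma independent_box (p q : I -> R) :
  P [set t | forall i, p i <= Z i t <= q i] =
  (\prod_i P [set t | (p i <= Z i t <= q i)%R])%E.
Proof.
have := Z_indep [set: I]%SET (fun i => measurable_itv `[p i, q i]).
have -> : \bigcap_(i in [set` [set: I]%SET]) Z i @^-1` `[p i, q i] =
    [set t | forall i, p i <= Z i t <= q i].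
  apply/seteqP; split => [t H i | t H i _ /=]; last by rewrite in_itv/= H.
  by have := H i (finset.in_setT i); rewrite /= in_itv.
move=> ->; apply: eq_big => [i|i _]; first by rewrite finset.in_setT.
by congr (P _); apply/seteqP; split => t /=; rewrite in_itv.
Qed.

Lemma independent_rays (q : I -> R) :
  P [set t | forall i, Z i t <= q i] = (\prod_i P [set t | (Z i t <= q i)%R])%E.
Proof.
have := Z_indep [set: I]%SET (fun i => measurable_itv `]-oo, q i]).
have -> : \bigcap_(i in [set` [set: I]%SET]) Z i @^-1` `]-oo, q i] =
    [set t | forall i, Z i t <= q i].
  apply/seteqP; split => [t H i | t H i _ /=]; last by rewrite in_itv/= H.
  by have := H i (finset.in_setT i); rewrite /= in_itv.
move=> ->; apply: eq_big => [i|i _]; first by rewrite finset.in_setT.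
by congr (P _); apply/seteqP; split => t /=; rewrite in_itv.
Qed.

Section AffineImage.
Variables (e f : I -> R).
Hypothesis e0 : forall i, 0 < e i.
Hypothesis elo : forall i, e i * lo i + f i <= lo i.
Hypothesis ehi : forall i, hi i <= e i * hi i + f i.

Let Y t i := e i * Z i t + f i.

(** By [elo] and [ehi] the image of the support contains the support, and the constant density of
    [Z i] is divided by [e i] there. *)
Lemma affine_ray i x :
  P [set t | lo i <= Y t i <= Num.min x (hi i)] =
  ((e i)^-1%:E * P [set t | (Z i t <= x)%R])%E.
Proof.
rewrite (uniform_ray _ (@Z_unif i)).
set y := Num.min x (hi i).
have [yl|ly] := ltP y (lo i).
  have E (W : T -> R) : [set t | lo i <= W t <= y] = set0.
    apply/seteqP; split => t //= /andP[h1 h2].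
    by move: (le_lt_trans (le_trans h1 h2) yl); rewrite ltxx.
  by rewrite !E measure0 mule0.
have yh : y <= hi i by rewrite /y ge_min lexx orbT.
have ei := e0 i; have := elo i; have := ehi i => h1 h2.
rewrite (uniform_itv_cc (@Z_unif i)) ?lexx//.
have -> : [set t | lo i <= Y t i <= y] = 
    [set t | (lo i - f i) / e i <= Z i t <= (y - f i) / e i].
  apply/seteqP; split => t /=; rewrite /Y ler_pdivrMr// ler_pdivlMr//;
   by move=> /andP[h3 h4]; apply/andP; split; lra.
rewrite (uniform_itv_cc (@Z_unif i)).
- rewrite -EFinM; congr (_%:E).
  have : hi i - lo i != 0 by rewrite lt0r_neq0// subr_gt0.
  move: (lt0r_neq0 ei) => *; field; exact/andP.
- by rewrite ler_pdivlMr//; lra.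
- by rewrite ler_pM2r ?invr_gt0//; lra.
- rewrite ler_pdivrMr//; lra.
Qed.

Lemma measurable_affine : measurable_fun setT (Y : T -> vec R I).
Proof.
apply: measurable_vec => i; apply: measurable_funD => //.
by apply: measurable_funM => //; exact: measurable_funP.
Qed.

Lemma measurable_vector : measurable_fun setT ((fun t i => Z i t) : T -> vec R I).
Proof. by apply: measurable_vec => i; exact: measurable_funP. Qed.

(** Both sides are finite measures in [A]. On lower orthants they agree by independence and
    [affine_ray], hence they agree on the generated sigma-algebra. *)
Lemma affine_law (A : set (vec R I)) : measurable A ->
  P [set t | A (Y t) /\ forall i, lo i <= Y t i <= hi i] =
  ((\prod_i (e i)^-1)%:E * P [set t | A (fun i => Z i t)])%E.
Proof.
move=> mA.
have mQ : measurable ([set z | forall i, lo i <= z i <= hi i] : set (vec R I)).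
  have -> : ([set z | forall i, lo i <= z i <= hi i] : set (vec R I)) =
    \bigcap_(i in [set: I]) ((fun z : vec R I => z i) @^-1` `[lo i, hi i]).
    apply/seteqP; split => [z H i _ /=|z H i]; first by rewrite in_itv/= H.
    by have := H i Logic.I; rewrite /= in_itv.
  apply: fin_bigcap_measurable => // i _.
  by rewrite -[X in measurable X]setTI; apply: measurable_coord.
have k0 : 0 <= \prod_i (e i)^-1 by apply: prodr_ge0 => i _; rewrite invr_ge0 ltW.
pose m1 := mrestr (measure_function_pushforward__canonical__measure_function_Measure
  P measurable_affine) mQ.
pose m2 := mscale (NngNum k0)
  (measure_function_pushforward__canonical__measure_function_Measure
    P measurable_vector).
suff : m1 A = m2 A by [].
apply: (@g_sigma_algebra_measure_unique _ _ (vec R I) (@lower_orthants R I) _ 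
  (fun k => [set z | forall i, z i <= k%:R])) => //.
- by move=> B GB; exact: sub_sigma_algebra.
- by move=> k; exists (fun=> k%:R).
- apply/seteqP; split => // z _; have [k zk] := vec_le_nat z; exists k => //=.
- move=> _ _ [x _ <-] [y _ <-]; exists (fun i => Num.min (x i) (y i)) => //.
  apply/seteqP; split => z /=.
    by move=> H; split => i; have := H i; rewrite le_min => /andP[].
  by move=> [H1 H2] i; rewrite le_min H1 H2.
- move=> _ [x _ <-].
  rewrite /m1 /m2 /mrestr /mscale /= /pushforward /=.
  transitivity (P [set t | forall i, (lo i - f i) / e i <= Z i t <=
      (Num.min (x i) (hi i) - f i) / e i]).
    congr (P _); apply/seteqP; split => t /=.
      move=> [H1 H2] i; rewrite ler_pdivrMr// ler_pdivlMr// lerBrDr lerBlDr.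
      by rewrite ![_ * e i]mulrC le_min; have := H2 i; have := H1 i; rewrite /Y => -> /andP[-> ->].
    move=> H; split=> i; have := H i; rewrite ler_pdivrMr// ler_pdivlMr// lerBrDr lerBlDr;
    by rewrite ![_ * e i]mulrC le_min => /and3P[h1 h2 h3] //; apply/andP; split.
  rewrite independent_box.
  transitivity ((\prod_i (e i)^-1)%:E * \prod_i P [set t | (Z i t <= x i)%R])%E;
    last by rewrite -independent_rays.
  transitivity (\prod_i ((e i)^-1%:E * P [set t | (Z i t <= x i)%R]))%E.
    apply: eq_bigr => i _; rewrite -affine_ray; congr (P _).
    apply/seteqP; split => t /=; rewrite ?[_ / _ <= _]ler_pdivrMr// ?[_ <= _ / _]ler_pdivlMr//;
     move=> /andP[h3 h4]; apply/andP; split; move: h3 h4; rewrite /Y; 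
     move: (Num.min _ _) => w; lra.
  by rewrite big_split /= -prodEFin.
- move=> k; rewrite /m1 /mrestr /= /pushforward.
  apply: (@le_lt_trans _ _ 1%E); last by rewrite ltry.
  apply: probability_le1; rewrite -[X in measurable X]setTI.
  apply: measurable_affine => //; apply: measurableI => //.
  exact: measurable_lower_orthant.
Qed.

End AffineImage.


(** Weierstrass product inequality; the bounds on the product itself are carried along to make the
    induction work. *)
Lemma prod1B_ge (x : I -> R) : (forall i, 0 <= x i <= 1) ->
  1 - \sum_i x i <= \prod_i (1 - x i).
Proof.
move=> x01.
suff [] : 1 - \sum_i x i <= \prod_i (1 - x i) /\ 0 <= \prod_i (1 - x i) <= 1 by [].
elim/big_rec2: _ => [|i p s _ [sp p01]]; first by rewrite subr0 lexx ler01.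
have /andP[x0 x1] := x01 i; move: p01 => /andP[p0 p1].
split; last apply/andP; last split; nra.
Qed.

(* The translates S + j h beta, j < J, are disjoint and fit in a box that is
   larger than the box of Z by a factor of at most 2 in volume. *)
Lemma disjoint_translates (S : set (vec R I)) (beta : I -> R) (h : R) (J : nat) :
  measurable S -> 0 < h ->
  (forall z tau, S z -> S (fun i => z i + tau * beta i) -> `|tau| < h) ->
  J%:R * (h * \sum_i `|beta i| / (hi i - lo i)) <= 1 / 2 ->
  (J%:R%:E * P [set t | S (fun i => Z i t)] <= 2%:E)%E.
Proof.
move=> mS h0 hS hJ.
have len0 i : 0 < hi i - lo i by rewrite subr_gt0.
have J0 : 0 <= J%:R :> R by rewrite ler0n.
pose eta i := J%:R * h * `|beta i| / (hi i - lo i).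
have eta0 i : 0 <= eta i by rewrite divr_ge0 ?(ltW (len0 i))// !mulr_ge0// ltW.
have etaE i : eta i * (hi i - lo i) = J%:R * h * `|beta i|.
  by rewrite /eta divfK// lt0r_neq0.
pose e i := 1 + eta i.
have e0 i : 0 < e i by rewrite /e; have := eta0 i; lra.
(* The map [z i -> e i * z i + f 0 i] sends the box to a box prolonged by [J h |beta i|] on the side
   to which [beta i] points; [s] moves the lower end when [beta i] is negative. The prolonged box
   contains every shift of the box by [j h beta], [j < J], and [f j] undoes the shift. *)
pose s i := if beta i < 0 then J%:R * h * `|beta i| else 0.
pose f (j : nat) i := lo i - s i - e i * lo i - j%:R * h * beta i.
pose F j := [set t | S (fun i => e i * Z i t + f j i) /\
                     forall i, lo i <= e i * Z i t + f j i <= hi i].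
have jh (j : nat) : (j < J)%N -> 0 <= j%:R * h <= J%:R * h.
  by move=> jJ; rewrite mulr_ge0 ?ler0n ?(ltW h0)// ler_pM2r// ler_nat ltnW.
have PF j : (j < J)%N -> P (F j) = 
    ((\prod_i (e i)^-1)%:E * P [set t | S (fun i => Z i t)])%E.
  move=> /jh /andP[j0 j1]; apply: affine_law => // i; rewrite /f /s.
    have [b0|b0] := ltP (beta i) 0; last by have := mulr_ge0 j0 b0; lra.
    have b1 : 0 <= - beta i by rewrite oppr_ge0 ltW.
    by rewrite ltr0_norm//; have := ler_wpM2r b1 j1; lra.
  rewrite [e i]/(1 + eta i) !mulrDl !mul1r.
  have := etaE i; have [b0|b0] := ltP (beta i) 0; last first.
    by rewrite ger0_norm//; have := ler_wpM2r b0 j1; lra.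
  have b1 : 0 <= - beta i by rewrite oppr_ge0 ltW.
  by rewrite ltr0_norm//; have := mulr_ge0 j0 b1; lra.
have mF j : measurable (F j).
  have -> : F j = (fun t i => e i * Z i t + f j i) @^-1`
     (S `&` \bigcap_(i in [set: I]) ((fun z : vec R I => z i) @^-1` `[lo i, hi i])).
    apply/seteqP; split => t.
      by move=> [St H]; split => // i _; rewrite /= in_itv/= H.
    by move=> [St H]; split => // i; have := H i Logic.I; rewrite /= in_itv.
  rewrite -[X in measurable X]setTI; apply: measurable_affine => //.
  apply: measurableI => //; apply: fin_bigcap_measurable => // i _.
  by rewrite -[X in measurable X]setTI; apply: measurable_coord.
(* An outcome in both [F j] and [F k] gives two points of [S] that differ by [(j - k) h beta], so
   [|j - k| < 1]. *)
have tF : trivIset setT F.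
  apply/trivIsetP => j k _ _ jk; apply/seteqP; split => // t [[Sj _] [Sk _]].
  have : `|(j%:R - k%:R) * h| < h.
    apply: (hS _ _ Sj); move: Sk; congr (S _); apply/funext => i; rewrite /f; ring.
  rewrite normrM (gtr0_norm h0) gtr_pMl// => jk1.
  have : `|(j%:Z - k%:Z)%:~R : R| < 1 by rewrite rmorphB.
  by rewrite -intr_norm (_ : 1 = 1%:~R)// ltr_int; lia.
(* The factors are [1 - eta / (1 + eta)], so the product is at least [1 - \sum_i eta i], and the
   hypothesis on [J] bounds this sum by 1/2. *)
have kap : 1 / 2 <= \prod_i (e i)^-1.
  have etaS : \sum_i eta i <= 1 / 2.
    apply: le_trans hJ; rewrite mulrA mulr_sumr ler_sum// => i _.
    by rewrite /eta mulrA.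
  have x01 i : 0 <= eta i / (1 + eta i) <= 1.
    have e1 := eta0 i; have e2 : 0 < 1 + eta i by lra.
    apply/andP; split; first by rewrite divr_ge0// ltW.
    by rewrite ler_pdivrMr//; lra.
  have -> : \prod_i (e i)^-1 = \prod_i (1 - eta i / (1 + eta i)).
    apply: eq_bigr => i _; have := e0 i; rewrite /e => /lt0r_neq0 e1; field.
    exact: e1.
  apply: le_trans (prod1B_ge x01).
  suff : \sum_i eta i / (1 + eta i) <= \sum_i eta i by lra.
  apply: ler_sum => i _; have e1 := eta0 i; have e2 : 0 < 1 + eta i by lra.
  by rewrite ler_pdivrMr//; nra.
have : (\sum_(j < J) P (F j) <= 1)%E.
  rewrite -measure_bigsetU//; apply: probability_le1.
  by apply: bigsetU_measurable.
rewrite (eq_bigr (fun=> ((\prod_i (e i)^-1)%:E * P [set t | S (fun i => Z i t)])%E)); last first.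
  by move=> j _; exact: PF.
have mZS : measurable [set t | S (fun i => Z i t)].
  by rewrite -[X in measurable X]setTI; apply: measurable_vector.
rewrite -(@fineK _ (P [set t | S (fun i => Z i t)])) ?fin_num_measure//.
have p0 : 0 <= fine (P [set t | S (fun i => Z i t)]) by rewrite fine_ge0.
under eq_bigr do rewrite -EFinM.
rewrite sumEFin sumr_const card_ord -EFinM !lee_fin -mulr_natl.
move: p0; set p := fine _; set k := \prod_i _ in kap *; nra.
Qed.

(** Takes the place of integrating along the lines of direction [beta]: if [S] were too likely, too
    many disjoint translates of it would fit into the enlarged box. *)
Lemma line_section_bound (S : set (vec R I)) (beta : I -> R) (h : R) :
  measurable S -> 0 < h ->
  (forall z tau, S z -> S (fun i => z i + tau * beta i) -> `|tau| < h) ->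
  (P [set t | S (fun i => Z i t)] <=
    (8 * h * \sum_i `|beta i| / (hi i - lo i))%:E)%E.
Proof.
move=> mS h0 hS.
set D := \sum_i _.
have D0 : 0 <= D.
  by apply: sumr_ge0 => i _; rewrite divr_ge0// ltW// subr_gt0.
have mZS : measurable [set t | S (fun i => Z i t)].
  by rewrite -[X in measurable X]setTI; apply: measurable_vector.
have := probability_le1 P mZS; have := @disjoint_translates S beta h _ mS h0 hS.
rewrite -/D -(@fineK _ (P _)) ?fin_num_measure//.
set p := fine _ => H; rewrite !lee_fin => p1.
rewrite leNgt; apply/negP => pD.
have p0 : 0 < p by apply: le_lt_trans pD; rewrite !mulr_ge0// ltW.
have /andP[t1 t2] := truncn_itv (ltW (divr_gt0 (ltr0n R 3) p0)).
(* With [J] the integer part of [3 / p], [J p <= 3] and [p > 8 h D] give [J h D <= 3/8], as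
   [disjoint_translates] requires; its conclusion [J p <= 2] contradicts [J p > 3 - p >= 2]. *)
have := H (Num.truncn (3 / p)); rewrite -EFinM lee_fin.
move: t1 t2; rewrite ler_pdivlMr// ltr_pdivrMr// -natr1; set J := _%:R => t1 t2.
have J0 : 0 <= J by rewrite ler0n.
have : J * (8 * h * D) <= J * p by rewrite ler_wpM2l// ltW.
move=> ? X; suff : J * p <= 2 by lra.
apply: X; lra.
Qed.

End Core.

(** * Dual bases and the distance delta *)

Section Dot.
Context {R : realType} {n : nat}.
Implicit Types (u v x y : 'cV[R]_n).

Lemma dotE u v : dot u v = \sum_k u k 0 * v k 0.
Proof. by rewrite /dot mxE; apply: eq_bigr => k _; rewrite mxE. Qed.

Lemma dotDr u x y : dot u (x + y) = dot u x + dot u y.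
Proof. by rewrite /dot mulmxDr mxE. Qed.
Lemma dotDl u v x : dot (u + v) x = dot u x + dot v x.
Proof. by rewrite /dot linearD mulmxDl mxE. Qed.
Lemma dotZr a u x : dot u (a *: x) = a * dot u x.
Proof. by rewrite /dot -scalemxAr mxE. Qed.
Lemma dotZl a u x : dot (a *: u) x = a * dot u x.
Proof. by rewrite /dot linearZ -scalemxAl mxE. Qed.
Lemma dotNr u x : dot u (- x) = - dot u x.
Proof. by rewrite /dot mulmxN mxE. Qed.
Lemma dotNl u x : dot (- u) x = - dot u x.
Proof. by rewrite /dot linearN mulNmx mxE. Qed.

Definition dot_linear := (dotDr, dotDl, dotZr, dotZl, dotNr, dotNl).

Lemma dot_suml (I : finType) (p : pred I) x (F : I -> 'cV[R]_n) :
  dot (\sum_(i | p i) F i) x = \sum_(i | p i) dot (F i) x.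
Proof. by rewrite /dot linear_sum /= mulmx_suml summxE. Qed.

Lemma dot_ge0 u : 0 <= dot u u.
Proof. by rewrite dotE; apply: sumr_ge0 => k _; rewrite -expr2 sqr_ge0. Qed.

Lemma enorm_ge0 u : 0 <= enorm u.
Proof. exact: sqrtr_ge0. Qed.

Lemma enormE u : enorm u ^+ 2 = \sum_k u k 0 ^+ 2.
Proof.
by rewrite /enorm sqr_sqrtr ?dot_ge0// dotE; under eq_bigr do rewrite -expr2.
Qed.

Lemma enormZ a u : enorm (a *: u) = `|a| * enorm u.
Proof.
by rewrite /enorm !dot_linear mulrA -expr2 sqrtrM ?sqr_ge0// sqrtr_sqr.
Qed.

Lemma coord_le_enorm u k : `|u k 0| <= enorm u.
Proof.
rewrite -ler_sqr ?nnegrE ?enorm_ge0// enormE (bigD1 k)//= real_normK ?num_real//.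
by rewrite lerDl sumr_ge0// => i _; rewrite sqr_ge0.
Qed.

Lemma dot_le_enorm u v : `|dot u v| <= enorm u * \sum_k `|v k 0|.
Proof.
rewrite dotE mulr_sumr (le_trans (ler_norm_sum _ _ _))// ler_sum// => k _.
by rewrite normrM ler_wpM2r// coord_le_enorm.
Qed.

End Dot.

Section Dual.
Context {R : realType} {m n : nat}.
Implicit Types (A : 'M[R]_(m, n)) (B : {set 'I_m}) (D : 'M[R]_(n, m)).
Implicit Types (q x : 'cV[R]_n).

(* The columns of D indexed by B are the basis dual to the rows of A in B. *)
Definition is_dual A B D : Prop :=
  [/\ D *m A = 1%:M, forall j k, j \in B -> (A *m D) j k = (j == k)%:R &
      forall k j, j \notin B -> D k j = 0].

Lemma dual_exists A B : #|B| = n ->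
  row_free (rowsub (@enum_val _ (mem B)) A) -> exists D, is_dual A B D.
Proof.
move=> cB; set M := rowsub _ A => fM.
have fullM : row_full M by rewrite /row_full (eqP fM); apply/eqP.
pose S : 'M[R]_(#|B|, m) := rowsub (@enum_val _ (mem B)) 1%:M.
(* The inverse of the basis matrix [M], with its columns put at the positions in [B] and zeros
   elsewhere. *)
exists (pinvmx M *m S); split.
- by rewrite -mulmxA -rowsubE mulVpmx.
- move=> j k jB.
  have -> : j = enum_val (enum_rank_in jB j) by rewrite enum_rankK_in.
  set r := enum_rank_in _ _.
  have -> : (A *m (pinvmx M *m S)) (enum_val r) k = (M *m pinvmx M *m S) r k.
    by rewrite -mulmxA !mxE; apply: eq_bigr => i _; rewrite !mxE.
  by rewrite mulmxVp// mul1mx !mxE.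
- move=> k j jB; rewrite mxE big1// => i _; rewrite !mxE.
  case: eqP => [E|_]; last by rewrite mulr0.
  by move: jB; rewrite -E enum_valP.
Qed.

(** For [D] dual to [B] this is the coefficient of row [j] in the expansion of [q] in the rows of
    [B]; the normal cone of the vertex with basis [B] consists of the [q] whose coefficients are all
    nonnegative. *)
Definition coord D q (j : 'I_m) : R := dot q (col j D).

Lemma coordDl D q q' j : coord D (q + q') j = coord D q j + coord D q' j.
Proof. exact: dotDl. Qed.
Lemma coordZl D a q j : coord D (a *: q) j = a * coord D q j.
Proof. exact: dotZl. Qed.

Section Fixed.
Variables (A : 'M[R]_(m, n)) (B : {set 'I_m}) (D : 'M[R]_(n, m)).
Hypothesis dualD : is_dual A B D.

Lemma coord0 q j : j \notin B -> coord D q j = 0.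
Proof.
case: dualD => _ _ D0 jB; rewrite /coord dotE big1// => k _.
by rewrite mxE D0// mulr0.
Qed.

Lemma coord_row i j : i \in B -> coord D (row i A)^T j = (i == j)%:R.
Proof.
case: dualD => _ DB _ iB; rewrite -DB// /coord /dot trmxK !mxE.
by apply: eq_bigr => k _; rewrite !mxE.
Qed.

Lemma dot_coord q x : dot q x = \sum_(j in B) coord D q j * (A *m x) j 0.
Proof.
case: dualD => DA _ _; rewrite /dot -{1}(mul1mx x) -DA -mulmxA mulmxA mxE.
rewrite (bigID (mem B)) /= [X in _ + X]big1 ?addr0.
  apply: eq_bigr => j _; congr (_ * _).
  by rewrite /coord /dot !mxE; apply: eq_bigr => k _; rewrite !mxE.
move=> j jB; rewrite -(mul0r ((A *m x) j 0)); congr (_ * _).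
rewrite -[RHS](coord0 q jB).
by rewrite /coord /dot !mxE; apply: eq_bigr => k _; rewrite !mxE.
Qed.

Lemma rowsum_coord q : q^T = \sum_(j in B) coord D q j *: row j A.
Proof.
apply/rowP => k; have := dot_coord q (delta_mx k 0).
rewrite dotE (bigD1 k)//= big1 ?addr0; last first.
  by move=> i ik; rewrite mxE (negbTE ik) mulr0.
rewrite mxE !eqxx mulr1 mxE => ->; rewrite summxE; apply: eq_bigr => j _.
rewrite !mxE; congr (_ * _); rewrite (bigD1 k)//= big1 ?addr0.
  by rewrite mxE !eqxx mulr1.
by move=> i ik; rewrite mxE (negbTE ik) mulr0.
Qed.

Lemma eq_dual x y : (forall j, j \in B -> (A *m x) j 0 = (A *m y) j 0) -> x = y.
Proof.
case: dualD => DA _ D0 xy.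
rewrite -(mul1mx x) -(mul1mx y) -DA -!mulmxA; apply/colP => k; rewrite !mxE.
apply: eq_bigr => j _; have [jB|jB] := boolP (j \in B); first by rewrite xy.
by rewrite D0// !mul0r.
Qed.

(** Column [j] of [D] annihilates the other rows of the basis, but not row [j]. *)
Lemma row_notin_span j : j \in B -> ~~ (row j A <= row_span A (B :\ j))%MS.
Proof.
move=> jB; apply/negP => sub.
have K : (row_span A (B :\ j) <= kermx (col j D))%MS.
  apply/sumsmx_subP => i; rewrite !inE => /andP[ij iB].
  rewrite genmxE; apply/sub_kermxP; apply/rowP => k; rewrite ord1.
  have := coord_row j iB; rewrite /coord /dot trmxK (negbTE ij) => ->.
  by rewrite mxE.
have /sub_kermxP/rowP/(_ 0) := submx_trans sub K.
have := coord_row j jB; rewrite /coord /dot trmxK eqxx => ->.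
by rewrite mxE => /eqP; rewrite oner_eq0.
Qed.

End Fixed.

Lemma dist_row_span_ge0 A I j : 0 <= dist_row_span A I j.
Proof.
apply: lb_le_inf; last by move=> _ [v _ <-]; exact: enorm_ge0.
by exists (enorm (row j A - 0)^T), 0 => //=; exact: sub0mx.
Qed.

Lemma delta_le A I j : ~~ (row j A <= row_span A I)%MS ->
  delta A <= dist_row_span A I j.
Proof.
move=> nsub; apply: ge_inf; last by exists (I, j).
by exists 0 => _ [Ij _ <-]; exact: dist_row_span_ge0.
Qed.

Lemma dist_row_span_le A I j (v : 'rV[R]_n) : (v <= row_span A I)%MS ->
  dist_row_span A I j <= enorm (row j A - v)^T.
Proof.
move=> sub; apply: ge_inf; last by exists v.
by exists 0 => _ [w _ <-]; exact: enorm_ge0.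
Qed.

(** Dividing [q] by its coefficient on row [j] leaves row [j] plus a combination of the other basis
    rows, a vector of norm at least [delta A]. *)
Lemma delta_coord_le A B D q j : is_dual A B D -> j \in B ->
  delta A * `|coord D q j| <= enorm q.
Proof.
move=> dD jB; have [->|mu0] := eqVneq (coord D q j) 0.
  by rewrite normr0 mulr0 enorm_ge0.
set mu := coord D q j in mu0 *.
rewrite -ler_pdivlMr ?normr_gt0// mulrC.
apply: le_trans (delta_le (row_notin_span dD jB)) _.
have -> : `|mu|^-1 * enorm q = enorm (row j A - (row j A - mu^-1 *: q^T))^T.
  by rewrite subKr linearZ /= trmxK enormZ normfV.
apply: dist_row_span_le.
pose q' := (row j A)^T - mu^-1 *: q.
have -> : row j A - mu^-1 *: q^T = q'^T.
  by apply/matrixP => a k; rewrite !mxE.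
rewrite [X in (X <= _)%MS](rowsum_coord dD); apply: summx_sub => i iB.
have [->|ij] := eqVneq i j.
  rewrite /q' coordDl -scaleNr coordZl (coord_row dD)// eqxx.
  by rewrite mulNr -/mu mulVf// subrr scale0r sub0mx.
apply: scalemx_sub; rewrite /row_span.
by apply: (sumsmx_sup i); rewrite ?inE ?ij// genmxE.
Qed.

Lemma dist_row_span_gt0 A I j : ~~ (row j A <= row_span A I)%MS ->
  0 < dist_row_span A I j.
Proof.
set K := row_span A I => nsub.
(* A vector [g] orthogonal to the span but not to row [j] bounds the distance from below, because
   pairing with [g] does not see the subtracted vector. *)
have [g [Kg jg]] : exists g : 'cV[R]_n, K *m g = 0 /\ dot (row j A)^T g != 0.
  move: nsub; rewrite submxE => /eqP/rowP/existsNP[k].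
  rewrite [RHS]mxE => /eqP H.
  exists (col k (cokermx K)); split; first by rewrite colE mulmxA mulmx_coker mul0mx.
  by rewrite /dot trmxK colE mulmxA -colE [X in X != 0]mxE.
set kap := dot _ g in jg.
set G := \sum_k `|g k 0|.
have G0 : 0 < G.
  rewrite lt_def sumr_ge0// andbT; apply: contraNneq jg => G0.
  have := dot_le_enorm (row j A)^T g; rewrite -/G G0 mulr0 normr_le0.
  by [].
apply: (@lt_le_trans _ _ (`|kap| / G)); first by rewrite divr_gt0 ?normr_gt0.
apply: lb_le_inf.
  by exists (enorm (row j A - 0)^T), 0 => //=; exact: sub0mx.
move=> _ [v /= vK <-]; rewrite ler_pdivrMr//.
apply: le_trans (dot_le_enorm _ _).
rewrite linearB /= dotDl dotNl.
suff -> : dot v^T g = 0 by rewrite subr0.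
by have /submxP[w ->] := vK; rewrite /dot trmxK -mulmxA Kg mulmx0 mxE.
Qed.

(** The infimum is over finitely many positive distances, and the inverse of one plus the sum of
    their inverses lies below each of them. A unit row with empty [I] shows that there is such a
    distance. *)
Lemma delta_gt0 A : (0 < m)%N -> (forall i, enorm (row i A)^T = 1) -> 0 < delta A.
Proof.
move=> m0 hA.
pose bad := [pred Ij : {set 'I_m} * 'I_m | ~~ (row Ij.2 A <= row_span A Ij.1)%MS].
pose F (Ij : {set 'I_m} * 'I_m) := dist_row_span A Ij.1 Ij.2.
have F0 Ij : bad Ij -> 0 < F Ij by exact: dist_row_span_gt0.
have S0 (p : pred _) : 0 <= \sum_(Ij | bad Ij && p Ij) (F Ij)^-1.
  by apply: sumr_ge0 => Ij /andP[/F0 h _]; rewrite invr_ge0 ltW.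
have S1 : 0 < 1 + \sum_(Ij | bad Ij && true) (F Ij)^-1 by have := S0 predT; rewrite /=; lra.
apply: (@lt_le_trans _ _ ((1 + \sum_(Ij | bad Ij && true) (F Ij)^-1)^-1)).
  by rewrite invr_gt0.
apply: lb_le_inf.
  exists (F (finset.set0, Ordinal m0)), (finset.set0, Ordinal m0) => //=.
  rewrite /row_span finset.big_set0 submx0; apply: contra_eqN (hA (Ordinal m0)) => /eqP ->.
  rewrite trmx0 /enorm dotE big1 ?sqrtr0 1?eq_sym ?oner_eq0// => k _.
  by rewrite mxE mul0r.
move=> _ [Ij /= bIj <-]; rewrite -/(F Ij).
rewrite -[leRHS]invrK lef_pV2 ?posrE ?invr_gt0 ?F0//.
under [in leRHS]eq_bigl do rewrite andbT.
rewrite (bigD1 Ij)//=; have := S0 [pred x | x != Ij]; rewrite /=; lra.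
Qed.

End Dual.

(** * Vertices and edges of the polyhedron *)

Lemma segment_sym (R : realType) (n : nat) (x y : 'cV[R]_n) :
  segment x y = segment y x.
Proof.
suff sub (u v : 'cV[R]_n) : segment u v `<=` segment v u by apply/seteqP.
move=> _ [t t01 <-]; exists (1 - t).
  by move: t01; rewrite /= !in_itv/= => /andP[h1 h2]; apply/andP; split; lra.
by rewrite subKr addrC.
Qed.

Section Polytope.
Context {R : realType} {m n : nat}.
Variables (A : 'M[R]_(m, n)) (b : 'cV[R]_m).
Let Q := polyhedron A b.
Implicit Types (q x y v c w z g : 'cV[R]_n) (D : 'M[R]_(n, m)) (B : {set 'I_m}).

Lemma dot_row i x : dot (row i A)^T x = (A *m x) i 0.
Proof. by rewrite /dot trmxK -row_mul mxE. Qed.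

Lemma tightP v i : reflect ((A *m v) i 0 = b i 0) (i \in tight A b v).
Proof. by rewrite inE; exact: eqP. Qed.

Lemma polyhedron_step v g : Q v -> (forall i, i \in tight A b v -> (A *m g) i 0 <= 0) ->
  exists2 eta : R, 0 < eta & Q (v + eta *: g).
Proof.
move=> Qv tg.
pose s i := b i 0 - (A *m v) i 0.
pose r i := `|(A *m g) i 0| / s i.
have s0 i : 0 <= s i by rewrite subr_ge0; exact: Qv.
have r0 i : 0 <= r i by rewrite divr_ge0.
have S0 : 0 < 1 + \sum_i r i by rewrite ltr_wpDr// sumr_ge0.
(* The step is below [s i / |(A g) i|] for every constraint with positive slack. A tight constraint
   has [s i = 0], hence [r i = 0]. *)
exists (1 + \sum_i r i)^-1; first by rewrite invr_gt0.
move=> i; rewrite mulmxDr -scalemxAr !mxE -lerBrDl.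
have -> : \sum_j A i j * v j 0 = (A *m v) i 0 by rewrite mxE.
have -> : \sum_j A i j * g j 0 = (A *m g) i 0 by rewrite mxE.
rewrite -/(s i) mulrC ler_pdivrMr//.
have [it|it] := boolP (i \in tight A b v).
  by apply: le_trans (tg i it) _; rewrite mulr_ge0// ltW.
have si : 0 < s i.
  by rewrite lt_def s0 andbT subr_eq0 eq_sym; move: it; rewrite inE.
apply: le_trans (ler_norm _) _.
have -> : `|(A *m g) i 0| = r i * s i by rewrite divfK// lt0r_neq0.
rewrite mulrC ler_pM2l// (bigD1 i)//=.
have : 0 <= \sum_(j | j != i) r j by apply: sumr_ge0.
lra.
Qed.

(** If [z] vanishes on the rows tight at [x], short steps along [z] and [- z] stay in the face,
    which at an end point of a segment forces [z = 0]. Hence the sum of the tight rows is maximal at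
    [x] only. *)
Lemma endpoint_vertex x y : is_face Q (segment x y) -> is_vertex Q x.
Proof.
move=> [f Ff].
have segx : segment x y x.
  by exists 0; [rewrite /= in_itv/= lexx ler01 | rewrite subr0 scale1r scale0r addr0].
have [Qx fx] : Q x /\ forall y, Q y -> dot f y <= dot f x by move: segx; rewrite Ff.
have triv z : (forall i, i \in tight A b x -> (A *m z) i 0 = 0) -> z = 0.
  move=> tz.
  have [e1 e10 Q1] : exists2 eta, 0 < eta & Q (x + eta *: z).
    by apply: polyhedron_step => // i /tz ->.
  have [e2 e20 Q2] : exists2 eta, 0 < eta & Q (x + eta *: - z).
    by apply: polyhedron_step => // i /tz E; rewrite mulmxN mxE E oppr0.
  have := fx _ Q1; have := fx _ Q2; rewrite !dot_linear => f1 f2.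
  have fz : dot f z = 0 by nra.
  have in1 : segment x y (x + e1 *: z).
    rewrite Ff; split => // u /fx; rewrite !dot_linear fz; lra.
  have in2 : segment x y (x + e2 *: - z).
    rewrite Ff; split => // u /fx; rewrite !dot_linear fz; lra.
  case: in1 => t1 /=; rewrite in_itv/= => /andP[t10 _] E1.
  case: in2 => t2 /=; rewrite in_itv/= => /andP[t20 _] E2.
  have {}E1 : t1 *: (y - x) = e1 *: z.
    by apply: (addrI x); rewrite -E1 scalerBl scale1r scalerBr addrA addrAC.
  have {}E2 : t2 *: (y - x) = e2 *: - z.
    by apply: (addrI x); rewrite -E2 scalerBl scale1r scalerBr addrA addrAC.
  apply/eqP; have : (e2 * t1 + e1 * t2) *: (y - x) = 0.
    by rewrite scalerDl -!scalerA E1 E2 scalerN scalerN !scalerA mulrC subrr.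
  move/eqP; rewrite scaler_eq0 => /orP[/eqP T|/eqP yx].
    have t1_0 : t1 = 0 by nra.
    by move: E1; rewrite t1_0 scale0r => /esym/eqP; rewrite scaler_eq0 (gt_eqF e10).
  by move: E1; rewrite yx scaler0 => /esym/eqP; rewrite scaler_eq0 (gt_eqF e10).
exists (\sum_(i in tight A b x) (row i A)^T).
have fE u : dot (\sum_(i in tight A b x) (row i A)^T) u =
    \sum_(i in tight A b x) (A *m u) i 0.
  by rewrite dot_suml; apply: eq_bigr => i _; rewrite dot_row.
apply/seteqP; split => [_ -> | u [Qu umax]].
  split => // u Qu; rewrite !fE; apply: ler_sum => i /tightP ->; exact: Qu.
have := umax x Qx; rewrite !fE => le.
apply/subr0_eq/triv => i it; rewrite mulmxBr mxE [X in _ + X]mxE.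
have le1 j : j \in tight A b x -> 0 <= (A *m x) j 0 - (A *m u) j 0.
  by move=> /tightP ->; rewrite subr_ge0; exact: Qu.
have := le1 i it.
have : \sum_(j in tight A b x | j != i) ((A *m x) j 0 - (A *m u) j 0) >= 0.
  by apply: sumr_ge0 => j /andP[/le1].
have : \sum_(j in tight A b x) ((A *m x) j 0 - (A *m u) j 0) <= 0.
  by rewrite sumrB subr_le0.
rewrite (bigD1 i)//=; lra.
Qed.

Lemma vertex_in v : is_vertex Q v -> Q v.
Proof.
move=> [f Ff].
by have [] : [set x | Q x /\ forall y, Q y -> dot f y <= dot f x] v by rewrite -Ff.
Qed.

(** Along [- col j D] constraint [j] loosens and the other constraints tight at [v] stay tight, so a
    short step is feasible and cannot increase the objective. *)
Lemma coord_ge0 v D q j : Q v -> is_dual A (tight A b v) D ->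
  (forall y, Q y -> dot q y <= dot q v) -> j \in tight A b v -> 0 <= coord D q j.
Proof.
move=> Qv dD qmax jt.
have [eta eta0 Qy] : exists2 eta : R, 0 < eta & Q (v + eta *: - col j D).
  apply: polyhedron_step => // i it; rewrite mulmxN mxE -dot_row.
  by rewrite -/(coord D _ j) (coord_row dD)// oppr_le0 ler0n.
have := qmax _ Qy; rewrite !dot_linear -/(coord D q j); nra.
Qed.

Lemma dot_vertexB v D q x : is_dual A (tight A b v) D ->
  dot q v - dot q x = \sum_(j in tight A b v) coord D q j * (b j 0 - (A *m x) j 0).
Proof.
move=> dD; rewrite !(dot_coord dD) -sumrB; apply: eq_bigr => j /tightP ->.
by rewrite mulrBr.
Qed.

(** The gap between [v] and [x] is a positive combination of the slacks of [x] in the rows tight at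
    [v]; if it is not positive, all these slacks vanish. *)
Lemma coord_gt0_max v D q x : is_dual A (tight A b v) D ->
  (forall j, j \in tight A b v -> 0 < coord D q j) ->
  Q x -> dot q v <= dot q x -> x = v.
Proof.
move=> dD pos Qx; rewrite -subr_le0 (dot_vertexB _ _ dD) => le.
have ge j : j \in tight A b v -> 0 <= coord D q j * (b j 0 - (A *m x) j 0).
  by move=> jt; rewrite mulr_ge0 ?(ltW (pos j jt))// subr_ge0; exact: Qx.
apply: (eq_dual dD) => j jt; move/tightP : (jt) => ->.
move: le; rewrite (bigD1 j)//=.
have : 0 <= \sum_(i in tight A b v | i != j) coord D q i * (b i 0 - (A *m x) i 0).
  by apply: sumr_ge0 => i /andP[/ge].
have := pos j jt; have := Qx j; have := ge j jt; nra.
Qed.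

(** [s] is the slope of the edge in the shadow. The line through an edge of the lower envelope
    supports the whole shadow, so both ends maximize [s c - w]. *)
Lemma shadow_step_slope c w x y : shadow_step A b c w x y ->
  exists s : R, (forall z, Q z -> dot (s *: c - w) z <= dot (s *: c - w) x) /\
    dot (s *: c - w) y = dot (s *: c - w) x.
Proof.
move=> [[_ [f Ff]] _ env].
rewrite /shadow !mxE /= => cxy.
have [Qx Qy] : Q x /\ Q y.
  have h t : 0 <= t <= 1 -> Q ((1 - t) *: x + t *: y).
    move=> t01; suff : segment x y ((1 - t) *: x + t *: y) by rewrite Ff => -[].
    by exists t; rewrite //= in_itv.
  split; first by have := h 0; rewrite lexx ler01 subr0 scale1r scale0r addr0; exact.
  by have := h 1; rewrite lexx ler01 subrr scale1r scale0r add0r; exact.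
have d0 : 0 < dot c y - dot c x by rewrite subr_gt0.
pose s := (dot w y - dot w x) / (dot c y - dot c x).
have sE : s * (dot c y - dot c x) = dot w y - dot w x by rewrite divfK// lt0r_neq0.
exists s; split; last by rewrite !dot_linear; lra.
have key t z' : 0 <= t <= 1 -> Q z' -> dot c z' = (1 - t) * dot c x + t * dot c y ->
    (1 - t) * dot w x + t * dot w y <= dot w z'.
  move=> t01 Qz' E.
  have [_ /(_ (shadow c w z'))] : lower_envelope (shadow c w @` Q)
      ((1 - t) *: shadow c w x + t *: shadow c w y).
    by apply: env; exists t; rewrite //= in_itv.
  rewrite /shadow !mxE /=; apply; last exact: E.
  by exists z'.
move=> z Qz; rewrite !dot_linear leNgt; apply/negP => lt.
have cvx u v t : 0 <= t <= 1 -> Q u -> Q v -> Q ((1 - t) *: u + t *: v).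
  move=> /andP[t0 t1] Qu Qv i; rewrite mulmxDr -!scalemxAr mxE [X in X + _]mxE [X in _ + X]mxE.
  have := Qu i; have := Qv i; nra.
pose mid : 'cV[R]_n := (1 - 2^-1) *: x + 2^-1 *: y.
have Qmid : Q mid by apply: cvx => //; apply/andP; split; lra.
have midE u : dot u mid = 2^-1 * (dot u x + dot u y).
  by rewrite /mid !dot_linear; lra.
clearbody mid.
pose d1 := dot c z - dot c mid.
pose L := dot c y - dot c x.
(* A point [z] below the line would pull the midpoint of the edge below it. The step [tau] keeps
   [tau |d1| <= L / 2], so the moved point is still above or below a point of the edge, with
   parameter [t]. *)
pose tau := (1 + `|d1| / L)^-1 / 2.
have r0 : 0 <= `|d1| / L by rewrite divr_ge0// ltW.
have tau0 : 0 < tau by rewrite /tau divr_gt0// invr_gt0; lra.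
have tau1 : tau <= 1.
  rewrite /tau ler_pdivrMr// mul1r (@le_trans _ _ 1)//; last by lra.
  by rewrite invf_le1//; lra.
have tauL : tau * (L + `|d1|) = L / 2.
  rewrite /tau; have : L != 0 by rewrite lt0r_neq0.
  have : L + `|d1| != 0 by rewrite lt0r_neq0// ltr_wpDr.
  by move=> h1 h2; field; rewrite h2.
pose t := 2^-1 + tau * d1 / L.
have L0 : 0 < L by [].
have tE : t * L = L / 2 + tau * d1.
  by rewrite /t mulrDl divfK ?lt0r_neq0//; lra.
have absd : - `|d1| <= d1 <= `|d1| by rewrite lerNnormlW// ler_norm.
have := key t ((1 - tau) *: mid + tau *: z).
have t01 : 0 <= t <= 1.
  move: absd => /andP[a1 a2]; apply/andP; split.
    rewrite -(pmulr_lge0 _ L0) tE; nra.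
  rewrite -(ler_pM2r L0) tE mul1r; nra.
move=> /(_ t01 (cvx _ _ _ _ Qmid Qz)); rewrite (ltW tau0) tau1 => /(_ isT).
rewrite !dot_linear !midE => H.
have {}H := H _.
have E : (1 - tau) * (2^-1 * (dot c x + dot c y)) + tau * dot c z =
  (1 - t) * dot c x + t * dot c y.
  by move: tE; rewrite /d1 midE /L; lra.
have := H E.
have tsE : t * (dot w y - dot w x) = s * (t * L) by rewrite -sE /L; ring.
have : (1 - t) * dot w x + t * dot w y = dot w x + s * (t * L) by rewrite -tsE; lra.
move=> ->; rewrite tE /d1 midE /L.
move: lt sE; nra.
Qed.

End Polytope.

(** * Crossings of the normal fan *)

Section Crossing.
Context {R : realType} {m n : nat}.
Variables (A : 'M[R]_(m, n)) (b : 'cV[R]_m).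
Let Q := polyhedron A b.
Implicit Types (q x y v c w z L : 'cV[R]_n) (D : 'M[R]_(n, m)) (B : {set 'I_m}).
Hypothesis nondeg : nondegenerate A b.

Definition vertex_basis B : Prop := exists2 v, is_vertex Q v & tight A b v = B.

Definition dual B : 'M[R]_(n, m) := xget 0 [set D | is_dual A B D].

Lemma dualP B : vertex_basis B -> is_dual A B (dual B).
Proof.
move=> [v /nondeg[cv fv] vB]; rewrite vB in cv fv.
by have [D dD] := dual_exists cv fv; apply: (xgetPex 0); exists D.
Qed.

(* q is interior to the normal cone with basis B, close to the wall that omits
   row i. *)
Definition crosses (h : R) q (i : 'I_m) B : Prop :=
  [/\ vertex_basis B, i \in B, coord (dual B) q i <= h &
      forall j, j \in B -> 0 < coord (dual B) q j].

(* For theta large, q + theta a_i is interior to both normal cones. *)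
Lemma cone_unique q i tau B B' : vertex_basis B -> vertex_basis B' ->
  i \in B -> i \in B' ->
  (forall j, j \in B -> 0 < coord (dual B) q j) ->
  (forall j, j \in B' -> 0 < coord (dual B') (q + tau *: (row i A)^T) j) ->
  B = B'.
Proof.
move=> vB vB' iB iB' posB posB'.
have dB := dualP vB; have dB' := dualP vB'.
case: vB => v vv vE; case: vB' => v' vv' vE'.
pose f := q + Num.max tau 0 *: (row i A)^T.
have Qv := vertex_in vv; have Qv' := vertex_in vv'.
have pos j : j \in tight A b v -> 0 < coord (dual B) f j.
  rewrite vE => jB; rewrite /f coordDl coordZl (coord_row dB)//.
  by rewrite ltr_wpDr ?posB// mulr_ge0 ?ler0n// le_max lexx orbT.
have pos' j : j \in tight A b v' -> 0 < coord (dual B') f j.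
  rewrite vE' => jB; have -> : f = (q + tau *: (row i A)^T) + (Num.max tau 0 - tau) *: (row i A)^T.
    by rewrite /f -addrA -scalerDl subrKC.
  rewrite coordDl [X in _ + X]coordZl (coord_row dB')//.
  by rewrite ltr_wpDr ?posB'// mulr_ge0 ?ler0n// subr_ge0 le_max lexx.
rewrite -vE in dB; rewrite -vE' in dB'; rewrite -vE -vE'.
have [le|le] := leP (dot f v) (dot f v').
  by rewrite vE in pos; rewrite (coord_gt0_max dB _ Qv' le)// vE.
by rewrite vE' in pos'; rewrite (coord_gt0_max dB' _ Qv (ltW le))// vE'.
Qed.

(** By [cone_unique] both points lie in the same cone. Their coordinates along row [i] differ by
    [tau] and both lie in the interval from 0, excluded, to [h]. *)
Lemma crosses_section h q i tau B B' : crosses h q i B ->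
  crosses h (q + tau *: (row i A)^T) i B' -> `|tau| < h.
Proof.
move=> [vB iB hB pB] [vB' iB' hB' pB'].
have E := cone_unique vB vB' iB iB' pB pB'; rewrite -{}E in hB' pB'.
have := pB i iB; have := pB' i iB; move: hB hB'.
rewrite coordDl coordZl (coord_row (dualP vB))// eqxx mulr1.
by rewrite ltr_norml => *; apply/andP; split; lra.
Qed.

Lemma crosses_inj h q i B B' : crosses h q i B -> crosses h q i B' -> B = B'.
Proof.
move=> [vB iB _ pB] [vB' iB' _ pB']; apply: (@cone_unique q i 0) => //.
by rewrite scale0r addr0.
Qed.

(* Equality would mean that the coordinates i and j of s c + L vanish for the
   same s. *)
Definition generic c L : Prop := forall B i j, vertex_basis B ->
  i \in B -> j \in B -> i != j -> coord (dual B) c i < 0 ->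
  coord (dual B) c i * coord (dual B) L j != coord (dual B) c j * coord (dual B) L i.

(** The ray [s c + L], with [L] in the role of [- w], leaves the normal cone of [B] through the
    relative interior of the wall omitting row [i]. *)
Definition exits c L B i (s : R) : Prop :=
  [/\ vertex_basis B, i \in B, 0 < s,
      s * coord (dual B) c i + coord (dual B) L i = 0 &
      coord (dual B) c i < 0 /\ forall j, j \in B -> j != i ->
        0 < s * coord (dual B) c j + coord (dual B) L j].

(** As [c] increases from [x] to [y], it has a negative coordinate at some row [i] on which [y] has
    slack. At the slope [s] of the edge, [x] and [y] tie, so coordinate [i] of [s c + L] is zero;
    genericity makes the others positive. *)
Lemma step_exits c L x0 x y : generic c L ->
  Q x0 -> (forall z, Q z -> dot L x0 <= dot L z -> z = x0) ->
  dot c x0 <= dot c x -> shadow_step A b c (- L) x y ->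
  exists i s, exits c L (tight A b x) i s.
Proof.
move=> gen Qx0 x0max cx0 step.
have [[_ edge] _ _] := step; rewrite /shadow !mxE /= => cxy.
have Vx := endpoint_vertex edge.
have Qy : Q y by apply: vertex_in; apply: (@endpoint_vertex _ _ _ A b y x); rewrite segment_sym.
have [s [qmax qy]] := shadow_step_slope step; rewrite opprK in qmax qy.
set q := s *: c + L in qmax qy.
have Qx := vertex_in Vx.
(* For [s <= 0], [y] would be at least as good as [x0] for [L], hence equal to [x0], although [c] is
   larger at [y]. *)
have s0 : 0 < s.
  rewrite ltNge; apply/negP => s0.
  have := qmax _ Qx0; rewrite -qy /q !dot_linear => q0.
  have yx0 : y = x0 by apply: x0max => //; nra.
  by move: cxy; rewrite yx0 ltNge cx0.
have vB : vertex_basis (tight A b x) by exists x.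
have dB := dualP vB; set D := dual _ in dB.
have mu0 j : j \in tight A b x -> 0 <= coord D q j by apply: coord_ge0.
pose r j := b j 0 - (A *m y) j 0.
have r0 j : 0 <= r j by rewrite subr_ge0; exact: Qy.
have : \sum_(j in tight A b x) coord D c j * r j < 0.
  by rewrite -(dot_vertexB _ _ dB) subr_lt0.
move=> lt0; have /existsP[i /andP[iB ci]] :
    [exists i, (i \in tight A b x) && (coord D c i * r i < 0)].
  apply: contraLR lt0; rewrite negb_exists -leNgt => /forallP H.
  by apply: sumr_ge0 => j jB; move: (H j); rewrite jB /= -leNgt.
have ri : 0 < r i 
  by rewrite lt_def r0 andbT; apply: contraTneq ci => ->; rewrite mulr0 ltxx.
have gi : coord D c i < 0 by rewrite pmulr_llt0 in ci.
have qE j : coord D q j = s * coord D c j + coord D L j by rewrite /q coordDl coordZl.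
have mui : coord D q i = 0.
  have : \sum_(j in tight A b x) coord D q j * r j = 0.
    by rewrite -(dot_vertexB _ _ dB) qy subrr.
  have ge0 j : j \in tight A b x -> 0 <= coord D q j * r j.
    by move=> jB; rewrite mulr_ge0// mu0.
  by move=> /(psumr_eq0P ge0)/(_ i iB)/eqP; rewrite mulf_eq0 (gt_eqF ri) orbF => /eqP.
exists i, s; split => //; first by rewrite -qE.
split => // j jB ji; rewrite -qE lt_def mu0// andbT.
apply/eqP => muj; have ij : i != j by rewrite eq_sym.
have /eqP := gen _ i j vB iB jB ij gi; apply.
rewrite -/D; move: mui muj; rewrite !qE => /eqP; rewrite addr_eq0 => /eqP li /eqP.
by rewrite addr_eq0 => /eqP lj; rewrite -[coord D L i]opprK -[coord D L j]opprK -li -lj; ring.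
Qed.

(** [dot c] strictly increases along the path, so no vertex repeats, and a nondegenerate vertex is
    determined by its tight rows. *)
Lemma exits_path c L x0 p : generic c L -> Q x0 ->
  (forall z, Q z -> dot L x0 <= dot L z -> z = x0) ->
  path (fun x y => `[< shadow_step A b c (- L) x y >]) x0 p ->
  uniq (map (tight A b) (belast x0 p)) /\
  forall B, B \in map (tight A b) (belast x0 p) -> exists i s, exits c L B i s.
Proof.
move=> gen Qx0 x0max pth.
have incr x y : `[< shadow_step A b c (- L) x y >] -> dot c x < dot c y.
  by move=> /asboolP[_ _ _]; rewrite /shadow !mxE.
have vtx : {in belast x0 p, forall x, is_vertex Q x /\ dot c x0 <= dot c x /\
     exists i s, exits c L (tight A b x) i s}.
  have gen_ind x : dot c x0 <= dot c x ->
     path (fun x y => `[< shadow_step A b c (- L) x y >]) x p ->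
     {in belast x p, forall x, is_vertex Q x /\ dot c x0 <= dot c x /\
     exists i s, exits c L (tight A b x) i s}.
    elim: p x {pth} => [//|y p IH] x x0x /= /andP[xy yp] z; rewrite inE => /orP[/eqP ->|zp].
      move: (xy) => /asboolP step; split; last by split => //; apply: step_exits step.
      by case: step => -[_ /endpoint_vertex].
    by apply: (IH y) => //; apply: le_trans x0x _; apply/ltW/incr.
  exact: gen_ind pth.
have uq : uniq (belast x0 p).
  apply: (@map_uniq _ _ (dot c)); apply: (@subseq_uniq _ _ (map (dot c) (x0 :: p))).
    by rewrite lastI map_rcons -cats1 prefix_subseq.
  apply: (@sorted_uniq _ <%R); [exact: lt_trans|exact: ltxx|].
  rewrite /= path_map; apply: sub_path pth; exact: incr.
split; last by move=> B /mapP[x /vtx[_ [_ E]] ->].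
rewrite map_inj_in_uniq// => x y /vtx[vx _] /vtx[vy _] E.
have vB : vertex_basis (tight A b x) by exists x.
apply: (eq_dual (dualP vB)) => j jB; move: (jB); rewrite E => jB'.
by move/tightP : jB => ->; move/tightP : jB' => ->.
Qed.

Lemma eventually_small (p : pred 'I_m) (g v : 'I_m -> R) :
  (forall j, p j -> 0 < v j) ->
  exists N0 : nat, forall N : nat, (N0 < N)%N -> forall j, p j -> `|g j| < N%:R * v j.
Proof.
move=> v0; have ge0 j : p j -> 0 <= `|g j| / v j.
  by move=> pj; rewrite divr_ge0// ltW// v0.
exists (Num.truncn (\sum_(j | p j) `|g j| / v j)) => N.
rewrite -(ltr_nat R) => lN j pj; rewrite -ltr_pdivrMr ?v0//.
apply: le_lt_trans (_ : \sum_(j | p j) `|g j| / v j < N%:R).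
  by rewrite (bigD1 j)//= lerDl sumr_ge0// => i /andP[/ge0].
have S0 : 0 <= \sum_(j | p j) `|g j| / v j by apply: sumr_ge0.
have /andP[_ lt] := truncn_itv S0.
by apply: lt_le_trans lt _; rewrite ler_nat -(ltr_nat R).
Qed.

(* Slots for the parameter s of the ray s c + L: the first kind covers (0, n]
   by intervals of length 1/N, the second one covers (n, oo), through 1/s, by
   intervals of length 1/(nN). slot_point is the end of the slot with the smaller s,
   where the ray has not yet left the normal cone. *)
Definition slot (N : nat) : finType := ('I_m * 'I_(n * N) + 'I_m * 'I_N)%type.

Definition slot_row N (e : slot N) : 'I_m :=
  match e with inl (i, _) => i | inr (i, _) => i end.

Definition slot_point N c L (e : slot N) : 'cV[R]_n :=
  match e with
  | inl (_, k) => (k%:R / N%:R) *: c + L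
  | inr (_, k) => c + (k.+1%:R / (n * N)%:R) *: L
  end.

(** At the slot end before the exit, coordinate [i] is at most its rate of change times the slot
    length. The other coordinates are positive at the exit, hence also at that slot end once [N] is
    large. *)
Lemma exits_crosses c L H B i s : (0 < n)%N -> 0 <= H -> exits c L B i s ->
  `|coord (dual B) c i| <= H -> `|coord (dual B) L i| <= n%:R * H ->
  exists N0 : nat, forall N : nat, (N0 < N)%N ->
    exists e : slot N, crosses (H / N%:R) (slot_point c L e) (slot_row e) B.
Proof.
move=> n0 H0 [vB iB s0 Ei [ci0 Ej]].
set D := dual B in ci0 Ej Ei *; set g := coord D c in ci0 Ej Ei *.
set l := coord D L in ci0 Ej Ei * => gH lH.
have nR : 0 < n%:R :> R by rewrite ltr0n.
have [sn|ns] := leP s n%:R.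
  have [|N0 HN0] := @eventually_small [pred j | (j \in B) && (j != i)] g
     (fun j => s * g j + l j); first by move=> j /andP[/Ej].
  exists N0 => N ltN; have NR : 0 < N%:R :> R by rewrite ltr0n (leq_trans _ ltN).
  (* [k / N] must lie strictly before [s], so the predecessor is taken when [s N] is an integer. *)
  have [k [ks sk]] : exists k : nat, k%:R < s * N%:R /\ s * N%:R <= k%:R + 1.
    have sN0 : 0 < s * N%:R by rewrite mulr_gt0.
    have /andP[t1 t2] := truncn_itv (ltW sN0); rewrite -natr1 in t2.
    have [E|ne] := eqVneq (Num.truncn (s * N%:R))%:R (s * N%:R); last first.
      by exists (Num.truncn (s * N%:R)); rewrite lt_neqAle ne t1 ltW.
    have : (0 < Num.truncn (s * N%:R))%N by rewrite -(ltr_nat R) E.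
    case: (Num.truncn _) E => // k <- _; exists k.
    by rewrite natr1 lexx ltr_nat.
  have kn : (k < n * N)%N.
    rewrite -(ltr_nat R) natrM; apply: lt_le_trans ks _.
    by rewrite ler_pM2r.
  have gi : - g i <= H by move: gH; rewrite ler_norml => /andP[]; lra.
  have iE : k%:R * g i + N%:R * l i = (s * N%:R - k%:R) * - g i.
    have -> : l i = - (s * g i) by lra.
    ring.
  exists (inl (i, Ordinal kn)); split => //=.
    rewrite coordDl coordZl -/g -/l ler_pdivlMr// mulrDl mulrAC divfK ?lt0r_neq0//.
    by rewrite [l i * _]mulrC iE; nra.
  move=> j jB; rewrite coordDl coordZl -/g -/l.
  rewrite -(pmulr_lgt0 _ NR) mulrDl mulrAC divfK ?lt0r_neq0// [l j * _]mulrC.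
  have [->|ji] := eqVneq j i; first by rewrite iE; nra.
  have /= := HN0 N ltN j; rewrite jB ji => /(_ isT).
  have gj := ler_norm (g j); have gj0 := normr_ge0 (g j).
  by move=> h1; nra.
have [|N0 HN0] := @eventually_small [pred j | (j \in B) && (j != i)] l
   (fun j => n%:R * (g j + s^-1 * l j)).
  move=> j /andP[jB ji]; rewrite mulr_gt0//.
  by rewrite -(pmulr_rgt0 _ s0) mulrDr mulVKf ?lt0r_neq0// Ej.
exists N0 => N ltN; have NR : 0 < N%:R :> R by rewrite ltr0n (leq_trans _ ltN).
have nN : 0 < (n * N)%:R :> R by rewrite natrM mulr_gt0.
(* In the parameter [1/s] the ray is traversed downwards, so the earlier slot end is [k + 1] with
   [k] the integer part of [x]; it is strictly beyond [x]. From [s > n] follows [x < N]. *)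
set x := s^-1 * (n * N)%:R.
have x0 : 0 <= x by rewrite mulr_ge0// ?invr_ge0 ltW.
have /andP[t1 t2] := truncn_itv x0; set k := Num.truncn x in t1 t2.
have kN : (k < N)%N.
  rewrite -(ltr_nat R); apply: le_lt_trans t1 _.
  by rewrite /x natrM mulrA gtr_pMl// mulrC ltr_pdivrMr// mul1r.
have li : l i = - (s * g i) by lra.
have li0 : 0 < l i by rewrite li oppr_gt0 pmulr_rlt0.
have lH' : l i <= n%:R * H by apply: le_trans lH; exact: ler_norm.
have iE : (n * N)%:R * g i + k.+1%:R * l i = (k.+1%:R - x) * l i.
  by rewrite /x mulrBl li; field; rewrite lt0r_neq0.
exists (inr (i, Ordinal kN)); split => //=.
  rewrite coordDl coordZl -/g -/l ler_pdivlMr// -(ler_pM2r nR).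
  have -> : (g i + k.+1%:R / (n * N)%:R * l i) * N%:R * n%:R =
     (n * N)%:R * g i + k.+1%:R * l i.
    by rewrite natrM; field; rewrite !lt0r_neq0.
  by rewrite iE -natr1; nra.
move=> j jB; rewrite coordDl coordZl -/g -/l.
rewrite -(pmulr_rgt0 _ nN).
have -> : (n * N)%:R * (g j + k.+1%:R / (n * N)%:R * l j) =
   (n * N)%:R * g j + k.+1%:R * l j.
  by rewrite mulrDr [_ * (_ / _ * _)]mulrA [_ * (_ / _)]mulrC divfK ?lt0r_neq0.
have [->|ji] := eqVneq j i; first by rewrite iE mulr_gt0// subr_gt0.
have /= := HN0 N ltN j; rewrite jB ji => /(_ isT).
have -> : N%:R * (n%:R * (g j + s^-1 * l j)) = (n * N)%:R * g j + x * l j.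
  by rewrite /x natrM; ring.
have lj := lerNnormlW (lexx `|l j|); have lj0 := normr_ge0 (l j).
by rewrite -natr1 in t2 *; nra.
Qed.

(** Every cone left by the path gets a slot for all large [N], and by [crosses_inj] different cones
    get different slots. *)
Lemma size_path_le c L H x0 p : (0 < n)%N -> 0 <= H -> generic c L -> Q x0 ->
  (forall z, Q z -> dot L x0 <= dot L z -> z = x0) ->
  (forall B i, vertex_basis B -> i \in B -> `|coord (dual B) c i| <= H) ->
  (forall B i, vertex_basis B -> i \in B -> `|coord (dual B) L i| <= n%:R * H) ->
  path (fun x y => `[< shadow_step A b c (- L) x y >]) x0 p ->
  exists N0 : nat, forall N : nat, (N0 < N)%N ->
    (size p <= #|[set e : slot N |
        `[< exists B, crosses (H / N%:R) (slot_point c L e) (slot_row e) B >]]%SET|)%N.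
Proof.
move=> n0 H0 gen Qx0 x0max cH LH pth.
have [uniqB exB] := exits_path gen Qx0 x0max pth.
set bs := map _ _ in uniqB exB.
have [N0 HN0] : exists N0 : nat, forall N : nat, (N0 < N)%N -> forall B, B \in bs ->
    exists e : slot N, crosses (H / N%:R) (slot_point c L e) (slot_row e) B.
  elim: {uniqB} bs exB => [|B bs IH] exB; first by exists 0%N.
  have [i [s ex]] := exB B (mem_head _ _).
  have [vB iB _ _ _] := ex.
  have [N1 H1] := exits_crosses n0 H0 ex (cH B i vB iB) (LH B i vB iB).
  have [N2 H2] : exists N0 : nat, forall N : nat, (N0 < N)%N -> forall B, B \in bs ->
      exists e : slot N, crosses (H / N%:R) (slot_point c L e) (slot_row e) B.
    by apply: IH => B' B'bs; apply: exB; rewrite inE B'bs orbT.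
  exists (maxn N1 N2) => N; rewrite gtn_max => /andP[N1N N2N] B'.
  by rewrite inE => /orP[/eqP ->|]; [exact: H1|exact: H2].
exists N0 => N /HN0 {}HN0.
have [->|sp] := eqVneq p [::]; first by [].
have [B0 B0bs] : exists B0, B0 \in bs.
  by case: p sp @bs {pth uniqB exB HN0} => // y p _; exists (tight A b x0); exact: mem_head.
have [e0 _] := HN0 B0 B0bs.
pose F B := xget e0 [set e : slot N | crosses (H / N%:R) (slot_point c L e) (slot_row e) B].
have FP B : B \in bs -> crosses (H / N%:R) (slot_point c L (F B)) (slot_row (F B)) B.
  move=> /HN0[e He]; apply: (xgetPex e0
    (P := [set e | crosses _ (slot_point c L e) (slot_row e) B])).
  by exists e.
have -> : size p = size (map F bs) by rewrite !size_map size_belast.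
rewrite cardE; apply: uniq_leq_size.
  rewrite map_inj_in_uniq// => B B' /FP h /FP h' E.
  by rewrite E in h; exact: crosses_inj h h'.
by move=> e /mapP[B /FP h ->]; rewrite mem_enum inE; apply/asboolP; exists B.
Qed.

End Crossing.

(** * Fatou bound for nonmeasurable functions *)

Section LowerIntegral.
Context {R : realType} {d : measure_display} {T : measurableType d}.
Variable mu : {measure set T -> \bar R}.
Local Open Scope ereal_scope.
Import HBNNSimple.

(* f need not be measurable: the integral of a nonnegative function is the
   supremum of the integrals of the simple functions below it. *)
Lemma ae_le_integral_nonmeasurable (f g : T -> \bar R) :
  (forall t, 0 <= f t) -> (forall t, 0 <= g t) -> measurable_fun setT g ->
  {ae mu, forall t, f t <= g t} -> \int[mu]_t f t <= \int[mu]_t g t.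
Proof.
move=> f0 g0 mg fg; rewrite [leLHS]ge0_integralTE//.
apply: ge_ereal_sup => _ [h /= hf <-]; rewrite -integralT_nnsfun.
apply: ae_ge0_le_integral => //.
- by move=> t _; rewrite lee_fin.
- exact/measurable_EFinP.
- by apply: filterS fg => t ft _; apply: le_trans (hf t) ft.
Qed.

Lemma measurable_fun_limn_einf (f : (T -> \bar R)^nat) :
  (forall n, measurable_fun setT (f n)) ->
  measurable_fun setT (fun t => limn_einf (f ^~ t)).
Proof.
move=> mf; under eq_fun do rewrite -[limn_einf _]oppeK -limn_esupN.
apply: measurableT_comp => //.
apply: (@measurable_fun_limn_esup _ _ _ setT (fun n t => - f n t)) => // n.
exact: measurableT_comp.
Qed.

Lemma le_limn_einf (u : (\bar R)^nat) x (n0 : nat) :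
  (forall n, (n0 < n)%N -> x <= u n) -> x <= limn_einf u.
Proof.
move=> xu; rewrite limn_einf_lim (cvg_lim _ (@cvg_einfs_sup R u))//.
apply: (@le_trans _ _ (einfs u n0.+1)); last by apply: ereal_sup_ubound; exists n0.+1.
by apply: le_ereal_inf_tmp => _ [k /= nk <-]; exact: xu.
Qed.

Lemma limn_einf_le (u : (\bar R)^nat) x :
  (forall n, (0 < n)%N -> u n <= x) -> limn_einf u <= x.
Proof.
move=> ux; rewrite limn_einf_lim (cvg_lim _ (@cvg_einfs_sup R u))//.
apply: ge_ereal_sup => _ [k _ <-]; apply: (le_trans _ (ux k.+1 _)) => //.
by apply: ereal_inf_lbound; exists k.+1 => /=.
Qed.

(** Almost everywhere [f] is below the lower limit of [g], whose integral is at most [M] by Fatou's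
    lemma. *)
Lemma ae_le_limn_einf_integral (f : T -> \bar R) (g : (T -> \bar R)^nat) M :
  (forall t, 0 <= f t) -> (forall n t, 0 <= g n t) ->
  (forall n, measurable_fun setT (g n)) ->
  {ae mu, forall t, exists n0 : nat, forall n, (n0 < n)%N -> f t <= g n t} ->
  (forall n, (0 < n)%N -> \int[mu]_t g n t <= M) -> \int[mu]_t f t <= M.
Proof.
move=> f0 g0 mg fg gM.
apply: (@le_trans _ _ (\int[mu]_t limn_einf (g ^~ t))).
  apply: ae_le_integral_nonmeasurable => //.
  - by move=> t; apply: (@le_limn_einf _ _ 0%N).
  - exact: measurable_fun_limn_einf.
  - by apply: filterS fg => t [n0 h]; exact: le_limn_einf h.
by apply: le_trans (limn_einf_le gM); exact: fatou.
Qed.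

End LowerIntegral.

Section UniformSupport.
Context {R : realType} {d : measure_display} {T : measurableType d}.
Variable P : probability T R.

Lemma ae_of_prob0 (A : set T) : measurable A -> P A = 0%E ->
  {ae P, forall t, ~ A t}.
Proof. by move=> mA PA; exists A; split => // t /= /contrapT. Qed.

Lemma uniform_ae (X : {RV P >-> R}) (a b : R) (ab : a < b) :
  (forall B, measurable B -> distribution P X B = uniform_prob ab B) ->
  {ae P, forall t, a <= X t <= b}.
Proof.
move=> hX; have mX : measurable [set t | a <= X t <= b].
  have -> : [set t | a <= X t <= b] = X @^-1` `[a, b].
    by apply/seteqP; split => t /=; rewrite in_itv.
  by rewrite -[X in measurable X]setTI; exact: measurable_funP.
exists (~` [set t | a <= X t <= b]); split => //; first exact: measurableC.
rewrite probability_setC// (uniform_itv_cc hX) ?lexx// ?ltW//.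
by rewrite divff ?subee// lt0r_neq0// subr_gt0.
Qed.

End UniformSupport.

(** * Probability of the slots *)

Section Setting.
Context {R : realType} {m n : nat}.
Variables (A : 'M[R]_(m, n)) (b : 'cV[R]_m) (x0 : 'cV[R]_n) (u : 'I_n -> 'I_m).
Let Q := polyhedron A b.
Hypothesis unit_rows : forall i, enorm (row i A)^T = 1.
Hypothesis nondeg : nondegenerate A b.
Hypothesis vertex_x0 : is_vertex Q x0.
Hypothesis u_inj : injective u.
Hypothesis tight_x0 : tight A b x0 = [set u k | k in 'I_n]%SET.
Hypothesis m_gt0 : (0 < m)%N.
Implicit Types (D : 'M[R]_(n, m)) (z : 'I_n + 'I_n -> R).

(** All randomness is collected in one vector [z]: its left half is [c], its right half is [lam].
    Thus [obj z] is [c], and [start_obj z] below is [- w]. *)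
Definition obj (z : 'I_n + 'I_n -> R) : 'cV[R]_n := \col_i z (inl i).

Definition start_obj (z : 'I_n + 'I_n -> R) : 'cV[R]_n :=
  (rowsub u A)^T *m \col_k z (inr k).

Let delta0 : 0 < delta A := delta_gt0 m_gt0 unit_rows.

Let vb0 : vertex_basis A b (tight A b x0).
Proof. by exists x0. Qed.

Let dual0 : is_dual A (tight A b x0) (dual A (tight A b x0)) := dualP nondeg vb0.

Let u_tight k : u k \in tight A b x0.
Proof. by rewrite tight_x0; apply: imset_f. Qed.

Definition start_coord (i : 'I_m) (k : 'I_n) : R :=
  coord (dual A (tight A b x0)) (row i A)^T (u k).

Lemma start_coord_le i k : `|start_coord i k| <= (delta A)^-1.
Proof.
rewrite -[leRHS]mulr1 ler_pdivlMl// -(unit_rows i).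
exact: (delta_coord_le _ dual0 (u_tight k)).
Qed.

Lemma start_objE z : start_obj z = \sum_k z (inr k) *: (row (u k) A)^T.
Proof.
apply/colP => i; rewrite summxE mxE; apply: eq_bigr => k _.
by rewrite !mxE mulrC.
Qed.

Lemma start_obj_coord i :
  \sum_k start_coord i k *: (row (u k) A)^T = (row i A)^T.
Proof.
rewrite -[RHS]trmxK; have := rowsum_coord dual0 (row i A)^T => ->.
rewrite linear_sum /= tight_x0 big_imset/=; last by move=> k l _ _; exact: u_inj.
by apply: eq_bigr => k _; rewrite linearZ /= /start_coord tight_x0.
Qed.

Lemma coord_obj D z j : coord D (obj z) j = \sum_k D k j * z (inl k).
Proof. by rewrite /coord dotE; apply: eq_bigr => k _; rewrite !mxE mulrC. Qed.

Lemma coord_start_obj D z j :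
  coord D (start_obj z) j = \sum_k coord D (row (u k) A)^T j * z (inr k).
Proof.
rewrite start_objE /coord dot_suml; apply: eq_bigr => k _.
by rewrite dotZl mulrC.
Qed.

(** The coordinates of [start_obj z] in the basis at [x0] are the positive numbers [z (inr k)], so
    it is interior to the normal cone of [x0]. *)
Lemma start_obj_unique z : (forall k, 0 < z (inr k)) ->
  forall y, Q y -> dot (start_obj z) x0 <= dot (start_obj z) y -> y = x0.
Proof.
move=> z0 y Qy; apply: (coord_gt0_max dual0) => // j.
rewrite {1}tight_x0 => /imsetP[k _ ->]; rewrite coord_start_obj (bigD1 k)//=.
rewrite (coord_row dual0)// eqxx mul1r big1 ?addr0// => l lk.
by rewrite (coord_row dual0)// (inj_eq u_inj) (negbTE lk) mul0r.
Qed.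

Lemma start_obj_le z : (forall k, 0 <= z (inr k) <= 1) ->
  forall B i, vertex_basis A b B -> i \in B ->
  `|coord (dual A B) (start_obj z) i| <= n%:R / delta A.
Proof.
move=> z01 B i vB iB; rewrite coord_start_obj.
apply: le_trans (ler_norm_sum _ _ _) _.
rewrite -[X in X%:R](card_ord n) -sum1_card natr_sum mulr_suml ler_sum// => k _.
have /andP[zk0 zk1] := z01 k.
rewrite normrM (ger0_norm zk0) mul1r.
apply: le_trans (_ : `|coord (dual A B) (row (u k) A)^T i| * 1 <= _).
  by rewrite ler_wpM2l.
rewrite mulr1 -[leRHS]mulr1 ler_pdivlMl// -(unit_rows (u k)).
exact: (delta_coord_le _ (dualP nondeg vB) iB).
Qed.

Lemma obj_le (c0 : 'cV[R]_n) phi z : enorm c0 = 1 -> Num.sqrt n%:R <= phi ->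
  0 < phi -> (forall i, `|z (inl i) - c0 i 0| <= phi^-1) ->
  forall B i, vertex_basis A b B -> i \in B ->
  `|coord (dual A B) (obj z) i| <= 2 / delta A.
Proof.
move=> c01 hphi phi0 zc0 B i vB iB.
suff norm2 : enorm (obj z) <= 2.
  rewrite mulrC ler_pdivlMl//; apply: le_trans norm2.
  exact: (delta_coord_le _ (dualP nondeg vB) iB).
rewrite -ler_sqr ?nnegrE ?enorm_ge0// enormE.
(* (a + e)^2 <= 2 a^2 + 2 e^2, and the deviation from c0 has norm <= 1 *)
apply: (@le_trans _ _ (\sum_k (2 * c0 k 0 ^+ 2 + 2 * phi^-1 ^+ 2))).
  apply: ler_sum => k _; rewrite mxE.
  have : (z (inl k) - c0 k 0) ^+ 2 <= phi^-1 ^+ 2.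
    rewrite -real_normK ?num_real// ler_sqr ?nnegrE ?invr_ge0 ?(ltW phi0)//.
  by have := sqr_ge0 (z (inl k) - 2 * c0 k 0); rewrite !expr2; nra.
rewrite big_split /= -!mulr_sumr -enormE c01 sumr_const card_ord -mulr_natl.
have : n%:R * phi^-1 ^+ 2 <= 1.
  rewrite exprVn ler_pdivrMr ?exprn_gt0// mul1r.
  rewrite -[n%:R]sqr_sqrtr ?ler0n// ler_sqr ?nnegrE ?sqrtr_ge0//.
  exact: ltW.
by rewrite expr1n; lra.
Qed.

Lemma sum_row_le i : (0 < n)%N -> \sum_k `|A i k| <= Num.sqrt n%:R.
Proof.
move=> n0; set r := Num.sqrt _.
have r0 : 0 < r by rewrite sqrtr_gt0 ltr0n.
have r2 : r ^+ 2 = n%:R by rewrite sqr_sqrtr ?ler0n.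
(* AM-GM: 2 |a| <= r a^2 + 1 / r *)
apply: (@le_trans _ _ (\sum_k ((r * A i k ^+ 2 + r^-1) / 2))).
  apply: ler_sum => k _; rewrite ler_pdivlMr//.
  have rr : r * r^-1 = 1 by rewrite divff// lt0r_neq0.
  rewrite -(ler_pM2l r0) -[A i k ^+ 2]real_normK ?num_real//.
  by have := sqr_ge0 (r * `|A i k| - 1); move: `|A i k| r^-1 rr => a s; nra.
have -> : \sum_k ((r * A i k ^+ 2 + r^-1) / 2) =
    (r * \sum_k A i k ^+ 2 + \sum_(k < n) r^-1) / 2.
  by rewrite -mulr_suml big_split /= -mulr_sumr.
have -> : \sum_k A i k ^+ 2 = 1.
  rewrite -(expr1n _ 2) -(unit_rows i) enormE; apply: eq_bigr => k _.
  by rewrite !mxE.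
have -> : \sum_(k < n) r^-1 = r.
  by rewrite sumr_const card_ord -[_ *+ n]mulr_natr -r2 expr2 mulKf ?lt0r_neq0.
lra.
Qed.

Notation V := (vec R ('I_n + 'I_n)%type).

Lemma measurable_obj D j :
  measurable_fun setT (fun z : V => coord D (obj z) j).
Proof.
have -> : (fun z : V => coord D (obj z) j) = (fun z : V => \sum_k D k j * z (inl k)).
  by apply/funext => z; exact: coord_obj.
apply: measurable_sum => k; apply: measurable_funM => //.
exact: measurable_coord.
Qed.

Lemma measurable_start_obj D j :
  measurable_fun setT (fun z : V => coord D (start_obj z) j).
Proof.
have -> : (fun z : V => coord D (start_obj z) j) =
    (fun z : V => \sum_k coord D (row (u k) A)^T j * z (inr k)).
  by apply/funext => z; exact: coord_start_obj.
apply: measurable_sum => k; apply: measurable_funM => //.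
exact: measurable_coord.
Qed.

Definition slot_event (H : R) N (e : @slot m n N) : set V :=
  [set z | exists B, crosses A b (H / N%:R) (slot_point (obj z) (start_obj z) e)
                             (slot_row e) B].

Lemma measurable_slot_point D j N (e : @slot m n N) :
  measurable_fun setT (fun z : V => coord D (slot_point (obj z) (start_obj z) e) j).
Proof.
case: e => -[i k] /=.
  have -> : (fun z : V => coord D ((k%:R / N%:R) *: obj z + start_obj z) j) =
      (fun z : V => k%:R / N%:R * coord D (obj z) j + coord D (start_obj z) j).
    by apply/funext => z; rewrite coordDl coordZl.
  apply: measurable_funD; last exact: measurable_start_obj.
  by apply: measurable_funM => //; exact: measurable_obj.
have -> : (fun z : V => coord D (obj z + (k.+1%:R / (n * N)%:R) *: start_obj z) j) =
    (fun z : V => coord D (obj z) j + k.+1%:R / (n * N)%:R * coord D (start_obj z) j).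
  by apply/funext => z; rewrite coordDl coordZl.
apply: measurable_funD; first exact: measurable_obj.
by apply: measurable_funM => //; exact: measurable_start_obj.
Qed.

Lemma measurable_slot_event H N (e : @slot m n N) : measurable (slot_event H e).
Proof.
have -> : slot_event H e = \bigcup_(B in [set: {set 'I_m}])
   [set z | crosses A b (H / N%:R) (slot_point (obj z) (start_obj z) e) (slot_row e) B].
  by apply/seteqP; split => [z [B HB]|z [B _ HB]]; exists B.
apply: fin_bigcup_measurable => // B _.
have [vB|nvB] := pselect (vertex_basis A b B /\ slot_row e \in B); last first.
  have -> : [set z | crosses A b (H / N%:R) (slot_point (obj z) (start_obj z) e)
      (slot_row e) B] = set0.
    by apply/seteqP; split => // z [vB eB _ _]; apply: nvB.
  exact: measurable0.
have -> : [set z : V | crosses A b (H / N%:R) (slot_point (obj z) (start_obj z) e) (slot_row e) B] =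
   [set z | coord (dual A B) (slot_point (obj z) (start_obj z) e) (slot_row e) <= H / N%:R] `&`
   \bigcap_(j in [set` B]) [set z | 0 < coord (dual A B) (slot_point (obj z) (start_obj z) e) j].
  apply/seteqP; split => z; first by case.
  by move=> [h1 h2]; split; [exact: vB.1|exact: vB.2|exact: h1|exact: h2].
apply: measurableI.
  rewrite -[X in measurable X]setTI; apply: measurable_fun_le => //.
  exact: measurable_slot_point.
apply: fin_bigcap_measurable => // j _.
have -> : [set z : V | 0 < coord (dual A B) (slot_point (obj z) (start_obj z) e) j] =
    ~` [set z : V | coord (dual A B) (slot_point (obj z) (start_obj z) e) j <= 0].
  by apply/seteqP; split => z /=; rewrite ltNge; move/negP.
apply: measurableC; rewrite -[X in measurable X]setTI; apply: measurable_fun_le => //.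
exact: measurable_slot_point.
Qed.

(** The direction in the space of [z] that moves [slot_point] by the row of the slot: it changes
    only [lam] for slots of the first kind and only [c] for the second kind. *)
Definition slot_direction N (e : @slot m n N) (k : 'I_n + 'I_n) : R :=
  match e, k with
  | inl (i, _), inr k => start_coord i k
  | inr (i, _), inl k => A i k
  | _, _ => 0
  end.

Lemma obj_shift z tau (beta : 'I_n + 'I_n -> R) :
  obj (fun k => z k + tau * beta k) = obj z + tau *: obj beta.
Proof. by apply/colP => k; rewrite !mxE. Qed.

Lemma start_obj_shift z tau (beta : 'I_n + 'I_n -> R) :
  start_obj (fun k => z k + tau * beta k) = start_obj z + tau *: start_obj beta.
Proof.
rewrite !start_objE scaler_sumr -big_split /=; apply: eq_bigr => k _.
by rewrite scalerDl scalerA.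
Qed.

Lemma slot_shift z tau N (e : @slot m n N) (beta := slot_direction e) :
  slot_point (obj (fun k => z k + tau * beta k))
             (start_obj (fun k => z k + tau * beta k)) e =
  slot_point (obj z) (start_obj z) e + tau *: (row (slot_row e) A)^T.
Proof.
rewrite obj_shift start_obj_shift {}/beta; case: e => -[i k] /=.
  have -> : obj (slot_direction (inl (i, k) : @slot m n N)) = 0.
    by apply/colP => l; rewrite !mxE.
  by rewrite scaler0 addr0 (start_objE (slot_direction _)) /= start_obj_coord addrA.
have -> : start_obj (slot_direction (inr (i, k) : @slot m n N)) = 0.
  by rewrite start_objE big1// => l _; rewrite /= scale0r.
rewrite scaler0 addr0 addrAC; congr (_ + _ *: _ + _).
by apply/colP => l; rewrite !mxE.
Qed.

Lemma slot_event_section H N (e : @slot m n N) z tau :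
  slot_event H e z -> slot_event H e (fun k => z k + tau * slot_direction e k) ->
  `|tau| < H / N%:R.
Proof.
by move=> [B HB] [B']; rewrite slot_shift => HB'; exact: crosses_section HB HB'.
Qed.

Definition tie_event (B : {set 'I_m}) (i j : 'I_m) : set V :=
  [set z | coord (dual A B) (obj z) i < 0 /\
     coord (dual A B) (obj z) i * coord (dual A B) (start_obj z) j =
     coord (dual A B) (obj z) j * coord (dual A B) (start_obj z) i].

Lemma measurable_tie_event B i j : measurable (tie_event B i j).
Proof.
set D := dual A B.
pose f1 z := coord D (obj z) i * coord D (start_obj z) j.
pose f2 z := coord D (obj z) j * coord D (start_obj z) i.
have m1 : measurable_fun setT (f1 : V -> R).
  by apply: measurable_funM; [exact: measurable_obj|exact: measurable_start_obj].
have m2 : measurable_fun setT (f2 : V -> R).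
  by apply: measurable_funM; [exact: measurable_obj|exact: measurable_start_obj].
have -> : tie_event B i j = ~` [set z : V | 0 <= coord D (obj z) i] `&`
   ([set z | f1 z <= f2 z] `&` [set z | f2 z <= f1 z]).
  apply/seteqP; split => z /=.
    by move=> [lt0 E]; split; [apply/negP; rewrite -ltNge | rewrite /f1 /f2 E].
  move=> [/negP h [h1 h2]]; rewrite -ltNge in h; split => //.
  by apply/eqP; rewrite eq_le h1 h2.
apply: measurableI; [apply: measurableC|apply: measurableI];
  rewrite -[X in measurable X]setTI; apply: measurable_fun_le => //.
exact: measurable_obj.
Qed.

(** The shift adds [tau] to coordinate [j] of [start_obj z] and keeps coordinate [i] and [obj z].
    The two sides of the tie then differ by [tau] times a negative number. *)
Lemma tie_event_section B i j z tau : vertex_basis A b B -> i \in B -> j \in B ->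
  i != j -> tie_event B i j z ->
  tie_event B i j (fun k => z k + tau *
    match k with inl _ => 0 | inr k => start_coord j k end) -> tau = 0.
Proof.
move=> vB iB jB ij [ci E]; rewrite /tie_event /= obj_shift start_obj_shift.
set beta := (fun k : 'I_n + 'I_n => _).
have -> : obj beta = 0 by apply/colP => l; rewrite !mxE.
rewrite scaler0 addr0 (start_objE beta) /= start_obj_coord => -[_].
have dB := dualP nondeg vB.
rewrite !coordDl !coordZl !(coord_row dB)// eqxx eq_sym (negbTE ij).
rewrite mulr1 mulr0 addr0 -E => /eqP; rewrite mulrDr -subr_eq0 addrAC subrr add0r.
by rewrite mulf_eq0 (lt_eqF ci) => /eqP.
Qed.

Section Random.
Context {d : measure_display} {T : measurableType d} {P : probability T R}.
Variables (phi : R) (lo hi : 'I_n -> R).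
Hypothesis lohi : forall i, lo i < hi i.
Hypothesis length : forall i, hi i - lo i = phi^-1.
Variables (c lam : 'I_n -> {RV P >-> R}).
Hypothesis c_unif : forall i (B : set R), measurable B ->
  distribution P (c i) B = uniform_prob (lohi i) B.
Hypothesis lam_unif : forall k (B : set R), measurable B ->
  distribution P (lam k) B = uniform_prob (@ltr01 R) B.
Let Z (k : 'I_n + 'I_n) : {RV P >-> R} :=
  match k with inl i => c i | inr i => lam i end.
Hypothesis Z_indep : mutually_independent Z.

Lemma prob_section_le (S : set V) (beta : 'I_n + 'I_n -> R) (h : R) :
  measurable S -> 0 < h ->
  (forall z tau, S z -> S (fun k => z k + tau * beta k) -> `|tau| < h) ->
  (P [set t | S (fun k => Z k t)] <= (8 * h *
    (phi * \sum_k `|beta (inl k)| + \sum_k `|beta (inr k)|))%:E)%E.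
Proof.
pose lo' (k : 'I_n + 'I_n) := match k with inl i => lo i | inr _ => 0 end.
pose hi' (k : 'I_n + 'I_n) := match k with inl i => hi i | inr _ => 1 end.
have lohi' k : lo' k < hi' k by case: k => i //=; exact: ltr01.
have Z_unif k B : measurable B -> distribution P (Z k) B = uniform_prob (lohi' k) B.
  by case: k => i mB; [exact: c_unif|exact: lam_unif].
move=> mS h0 hS; have := line_section_bound Z_unif Z_indep mS h0 hS.
rewrite big_sumType /= => /le_trans; apply; rewrite lee_fin.
have -> : \sum_k `|beta (inl k)| / (hi' (inl k) - lo' (inl k)) =
    phi * \sum_k `|beta (inl k)|.
  by rewrite mulr_sumr; apply: eq_bigr => k _; rewrite /hi' /lo' length invrK mulrC.
have -> : \sum_k `|beta (inr k)| / (hi' (inr k) - lo' (inr k)) =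
    \sum_k `|beta (inr k)|.
  by apply: eq_bigr => k _; rewrite /hi' /lo' subr0 divr1.
exact: lexx.
Qed.

Hypothesis phi_gt0 : 0 < phi.

Lemma tie_event0 B i j : vertex_basis A b B -> i \in B -> j \in B -> i != j ->
  P [set t | tie_event B i j (fun k => Z k t)] = 0%E.
Proof.
move=> vB iB jB ij; apply/eqP; rewrite eq_le measure_ge0 andbT.
pose beta (k : 'I_n + 'I_n) := match k with inl _ => 0 | inr k => start_coord j k end.
pose K := 8 * (phi * \sum_k `|beta (inl k)| + \sum_k `|beta (inr k)|).
have K0 : 0 <= K.
  by rewrite mulr_ge0// addr_ge0 ?mulr_ge0 ?(ltW phi_gt0)//; apply: sumr_ge0.
apply/lee_addgt0Pr => eps eps0; rewrite add0e.
(* Sections of a tie are single points, so every positive [h] is allowed; this one makes the bound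
   at most [eps], also when [K = 0]. *)
have h0 : 0 < eps / (K + 1) by rewrite divr_gt0// ltr_wpDl.
apply: (le_trans (prob_section_le (beta := beta) (measurable_tie_event B i j) h0 _)).
  by move=> z tau tz tz'; rewrite (tie_event_section vB iB jB ij tz tz') normr0.
rewrite lee_fin mulrAC -/K mulrC -mulrA ger_pMr// mulrC ler_pdivrMr ?ltr_wpDl//.
by rewrite mul1r lerDl.
Qed.

Lemma slot_event_le H N (e : @slot m n N) : (0 < n)%N -> (0 < N)%N -> 0 < H ->
  (P [set t | slot_event H e (fun k => Z k t)] <=
   (8 * (H / N%:R) * match e with
     | inl _ => n%:R / delta A | inr _ => phi * Num.sqrt n%:R end)%:E)%E.
Proof.
move=> n0 N0 H0; have h0 : 0 < H / N%:R by rewrite divr_gt0// ltr0n.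
apply: (le_trans (prob_section_le (beta := slot_direction e)
  (measurable_slot_event H e) h0 (@slot_event_section H N e))).
rewrite lee_fin ler_pM2l; last by rewrite mulr_gt0.
case: e => -[i k] /=.
  rewrite big1 ?mulr0 ?add0r => [|l _]; last by rewrite normr0.
  have -> : n%:R / delta A = \sum_(k < n) (delta A)^-1.
    by rewrite sumr_const card_ord mulr_natl.
  by apply: ler_sum => l _; exact: start_coord_le.
rewrite [X in _ + X]big1 ?addr0 => [|l _]; last by rewrite normr0.
by rewrite ler_pM2l//; exact: sum_row_le.
Qed.

Lemma ae_generic :
  {ae P, forall t, generic A b (obj (fun k => Z k t)) (start_obj (fun k => Z k t))}.
Proof.
have H : {ae P, forall t, forall Bij : {set 'I_m} * ('I_m * 'I_m),
    vertex_basis A b Bij.1 -> Bij.2.1 \in Bij.1 -> Bij.2.2 \in Bij.1 ->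
    Bij.2.1 != Bij.2.2 -> ~ tie_event Bij.1 Bij.2.1 Bij.2.2 (fun k => Z k t)}.
  apply: filter_forall => -[B [i j]] /=.
  have [[vB [iB [jB ij]]]|no] := pselect (vertex_basis A b B /\ i \in B /\ j \in B /\ i != j).
    have : {ae P, forall t, ~ tie_event B i j (fun k => Z k t)}.
      apply: ae_of_prob0; last exact: tie_event0.
      rewrite -[X in measurable X]setTI; apply: measurable_vec => //.
      exact: measurable_tie_event.
    by apply: filterS => t nt _ _ _ _.
  by apply: aeW => t vB iB jB ij; case: no.
apply: filterS H => t H B i j vB iB jB ij ci; apply/eqP => E.
by apply: (H (B, (i, j))).
Qed.

(** There are [m n N] slots of the first kind and [m N] of the second, each with probability of
    order [1 / N], so [N] cancels. *)
Lemma expected_slots_le H N : (0 < n)%N -> (0 < N)%N -> 0 < H ->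
  (\int[P]_t (\sum_(e : @slot m n N) (\1_(slot_event H e) (fun k => Z k t))%:E) <=
  (8 * H * (m%:R * n%:R ^+ 2 / delta A + m%:R * Num.sqrt n%:R * phi))%:E)%E.
Proof.
move=> n0 N0 H0.
have mS (e : @slot m n N) : measurable [set t | slot_event H e (fun k => Z k t)].
  rewrite -[X in measurable X]setTI; apply: measurable_vec => //.
  exact: measurable_slot_event.
have indE (e : @slot m n N) t : (\1_(slot_event H e) (fun k => Z k t))%:E =
    (\1_[set t | slot_event H e (fun k => Z k t)] t)%:E :> \bar R.
  by rewrite !indicE; congr (_ _)%:E; apply/idP/idP; rewrite !inE.
under eq_integral do under eq_bigr do rewrite indE.
rewrite ge0_integral_sum//; last first.
  by move=> e; apply/measurable_EFinP; exact: measurable_indic.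
under eq_bigr do rewrite integral_indic// setIT.
apply: le_trans (lee_sum _ (fun e _ => slot_event_le e n0 N0 H0)) _.
rewrite sumEFin lee_fin big_sumType /= !sumr_const !card_prod !card_ord.
have NR : N%:R != 0 :> R by rewrite pnatr_eq0 -lt0n.
have dA : delta A != 0 by rewrite lt0r_neq0.
rewrite -[_ *+ (m * (n * N))]mulr_natr -[_ *+ (m * N)]mulr_natr.
rewrite (natrM R m (n * N)) (natrM R n N) (natrM R m N).
set r := Num.sqrt _; move: r (delta A) dA (m%:R : R) (n%:R : R) (N%:R : R) NR.
move=> r D D0 m' n' N' N'0; rewrite le_eqVlt; apply/orP; left; apply/eqP.
field; exact/andP.
Qed.

End Random.

End Setting.

(** * Expected number of edges of the path *)

Theorem theorem3 (R : realType) :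
  exists C : R, 0 < C /\
  forall (m n : nat) (A : 'M[R]_(m, n)) (b : 'cV[R]_m)
    (hA : forall i, enorm (row i A)^T = 1)
    (hbounded : bounded_set (polyhedron A b))
    (hnondeg : nondegenerate A b)
    (c0 x0 : 'cV[R]_n)
    (hc0 : enorm c0 = 1)
    (hx0 : is_vertex (polyhedron A b) x0)
    (phi : R) (hphi : Num.sqrt n%:R <= phi)
    (lo hi : 'I_n -> R)
    (hlohi : forall i, lo i < hi i)
    (hlength : forall i, hi i - lo i = phi^-1)
    (hrange : forall i, -1 <= lo i /\ hi i <= 1)
    (hcontains : forall i, lo i <= c0 i 0 <= hi i)
    (u : 'I_n -> 'I_m) (hu : injective u)
    (htight : tight A b x0 = [set u k | k in 'I_n]%SET)
    (d : measure_display) (T : measurableType d) (P : probability T R)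
    (c lam : 'I_n -> {RV P >-> R})
    (hc : forall i (B : set R), measurable B ->
       distribution P (c i) B = uniform_prob (hlohi i) B)
    (hlam01 : forall k t, 0 < lam k t <= 1)
    (hlam : forall k (B : set R), measurable B ->
       distribution P (lam k) B = uniform_prob (@ltr01 R) B)
    (hindep : mutually_independent
       (fun k : 'I_n + 'I_n => match k with inl i => c i | inr i => lam i end))
    (output : T -> seq 'cV[R]_n)
    (houtput : {ae P, forall t,
       shadow_path A b (\col_i c i t)
         (shadow_objective A u (\col_k lam k t)) x0 (output t)}),
  ('E_P[fun t => (size (output t))%:R] <=
    (C * (m%:R * n%:R ^+ 2 / delta A ^+ 2
          + m%:R * Num.sqrt n%:R * phi / delta A))%:E)%E.
Proof.
(* The factor 8 of [line_section_bound] times the 2 in [H]. *)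
exists 16; split; first by [].
move=> m n A b hA _ hnondeg c0 x0 hc0 hx0 phi hphi lo hi hlohi hlength _ hcontains.
move=> u hu htight d T P c lam hc hlam01 hlam hindep output houtput.
have n0 : (0 < n)%N.
  rewrite lt0n; apply/eqP => n0; move/eqP: hc0; apply/negP.
  rewrite /enorm dotE big1 ?sqrtr0 1?eq_sym ?oner_eq0// => k.
  by have := ltn_ord k; rewrite [X in (_ < X)%N]n0.
have m0 : (0 < m)%N by apply: leq_ltn_trans (ltn_ord (u (Ordinal n0))).
have phi0 : 0 < phi by apply: lt_le_trans hphi; rewrite sqrtr_gt0 ltr0n.
have d0 : 0 < delta A := delta_gt0 m0 hA.
pose Z (k : 'I_n + 'I_n) : {RV P >-> R} :=
  match k with inl i => c i | inr i => lam i end.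
pose zt t (k : 'I_n + 'I_n) : R := Z k t.
have objE t : obj (zt t) = \col_i c i t by apply/colP => k; rewrite !mxE.
have startE t : shadow_objective A u (\col_k lam k t) = - start_obj A u (zt t) by [].
(* The perturbed [c] has norm at most 2, so [H] bounds its coordinates in every vertex basis; those
   of [- w] are at most [n / delta A], hence at most [n H]. *)
pose H := 2 / delta A.
have H0 : 0 < H by rewrite divr_gt0.
(* The path length is compared with the number of slots whose event occurs, a measurable function
   for every [N]. *)
rewrite unlock; apply: (@ae_le_limn_einf_integral _ _ _ P _ (fun N t =>
  \sum_(e : @slot m n N) (\1_(slot_event A b u H e) (zt t))%:E)%E).
- by move=> t; rewrite lee_fin.
- by move=> N t; apply: sume_ge0 => e _; rewrite lee_fin.
- move=> N; apply: emeasurable_sum => e; apply/measurable_EFinP.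
  have -> : (fun t => \1_(slot_event A b u H e) (zt t) : R) =
      \1_[set t | slot_event A b u H e (zt t)].
    by apply/funext => t; rewrite !indicE; congr (_%:R); apply/idP/idP; rewrite !inE.
  apply: measurable_indic; rewrite -[X in measurable X]setTI.
  apply: measurable_vec => //; exact: measurable_slot_event.
- have gen := ae_generic hnondeg hx0 hu htight hlength hc hlam hindep phi0.
  have range : {ae P, forall t, forall i, lo i <= c i t <= hi i}.
    by apply: filter_forall => i; exact: uniform_ae (hc i).
  apply: filterS3 gen range houtput => t gen range [pth _].
  have [N0 HN0] : exists N0 : nat, forall N : nat, (N0 < N)%N ->
    (size (output t) <= #|[set e : @slot m n N |
        `[< exists B, crosses A b (H / N%:R) (slot_point (obj (zt t)) (start_obj A u (zt t)) e)
              (slot_row e) B >]]%SET|)%N.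
    apply: (size_path_le hnondeg n0 (ltW H0) gen (vertex_in hx0)).
    - apply: (start_obj_unique hnondeg hx0 hu htight) => k.
      by have /andP[] := hlam01 k t.
    - apply: (obj_le hA hnondeg m0 hc0 hphi phi0) => i.
      have /andP[l1 l2] := range i; have /andP[l3 l4] := hcontains i.
      by rewrite ler_norml -(hlength i); apply/andP; split; rewrite /zt /=; lra.
    - move=> B i vB iB; apply: (@le_trans _ _ (n%:R / delta A)).
        apply: (@start_obj_le _ _ _ A b u hA hnondeg m0 (zt t) _ B i vB iB) => k.
        by have /andP[l1 l2] := hlam01 k t; rewrite /zt /= (ltW l1).
      by rewrite /H mulrA ler_pM2r ?invr_gt0// ler_peMr// ler1n.
    - by move: pth; rewrite objE startE.
  exists N0 => N /HN0; rewrite -(ler_nat R) => /le_trans le.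
  rewrite sumEFin lee_fin; apply: le.
  rewrite -sum1_card natr_sum big_mkcond /=; apply: ler_sum => e _.
  rewrite indicE inE; case: asboolP => // ex.
  by rewrite mem_set.
- move=> N N0.
  apply: le_trans (expected_slots_le hA hnondeg hx0 hu htight m0 hlength hc hlam hindep
    phi0 n0 N0 H0) _.
  rewrite lee_fin /H le_eqVlt; apply/orP; left; apply/eqP.
  set r := Num.sqrt _; move: r (delta A) d0 (m%:R : R) (n%:R : R) => r D /lt0r_neq0 D0 m' n'.
  by field.
Qed.
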